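(* Let $\tau=\frac{\sqrt{5}+1}{2}$. For each integer $n\ge 1$ let $\beta_n$ be the largest positive root of $h_n(x)=x^{n+1}-(1+x+\cdots+x^{n-1})$, and let $\alpha_n=\beta_n^{1/2}+\beta_n^{-1/2}$. Then the set of all real numbers that are limit points of the largest matching roots of graphs is exactly $$\{\alpha_1,\alpha_2,\ldots\}\cup\left[\tau^{1/2}+\tau^{-1/2},+\infty\right),$$ where $2=\alpha_1<\alpha_2<\cdots$ and $\lim_{n\to\infty}\alpha_n=\tau^{1/2}+\tau^{-1/2}=\sqrt{2+\sqrt{5}}$.
   Context: All graphs are finite, simple and undirected. A matching of a graph $G$ is a set $M$ of edges, no two distinct of which share a vertex; the empty set is a matching. $\mathcal{M}(G)$ denotes the set of all matchings of $G$, and $V(M)$ the set of vertices covered by $M$. The matching polynomial of $G$ is $$\mathscr{M}(G,x)=\sum_{M\in\mathcal{M}(G)}(-1)^{|M|}x^{|V(G)\setminus V(M)|}.$$ All its roots are real; $\mu(G)$ denotes its largest root, called the largest matching root of $G$. A real number $\gamma$ is called a limit point of the largest matching roots of graphs if there is a sequence of graphs $\{G_i\mid i\in\mathbb{N}\}$ such that $\mu(G_i)\ne\mu(G_j)$ whenever $i\ne j$ and $\lim_{i\to\infty}\mu(G_i)=\gamma$. *)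

(* Defs.v *)
From HB Require Import structures.
From mathcomp Require Import all_boot all_order all_algebra.
From mathcomp Require Import all_classical all_reals all_analysis.
Import Order.TTheory GRing.Theory Num.Theory.
Import numFieldNormedType.Exports.

Set Implicit Arguments.
Unset Strict Implicit.
Unset Printing Implicit Defensive.

Local Open Scope classical_set_scope.
Local Open Scope ring_scope.

Record sgraph := SGraph {
  vertex :> finType;
  adj : rel vertex;
  adj_sym : symmetric adj;
  adj_irrefl : irreflexive adj }.

Definition edges (G : sgraph) : {set {set G}} :=
  [set [set p.1; p.2] | p : G * G & adj p.1 p.2]%SET.

(* [trivIset] and [cover] also exist in classical_sets; here the finset versions
   are meant. *)
Definition is_matching (G : sgraph) (M : {set {set G}}) : bool :=
  (M \subset edges G) && finset.trivIset M.

Definition matching_poly (R : realType) (G : sgraph) : {poly R} :=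
  \sum_(M : {set {set G}} | is_matching M)
    (-1) ^+ #|M| *: 'X^#|(~: finset.cover M)%SET|.

(* The greatest element of A, and 0 when A has none. *)
Definition maximum (R : realType) (A : set R) : R :=
  xget 0 (A `&` ubound A).

Lemma maximumE (R : realType) (A : set R) (x : R) :
  A x -> ubound A x -> maximum A = x.
Proof.
move=> Ax ubx; apply: xget_unique => [//|y [Ay uby]].
by apply/le_anti/andP; split; [exact: ubx|exact: uby].
Qed.

(* The graph without vertices has matching polynomial 1, hence no root; it gets
   the value 0, which is also the value of the one-vertex graph, so it does not
   affect the limit points below. *)
Definition mu (R : realType) (G : sgraph) : R :=
  maximum [set x : R | root (matching_poly R G) x].

Definition is_limit_point (R : realType) (gamma : R) : Prop :=
  exists G : nat -> sgraph,
    (forall i j : nat, i <> j -> mu R (G i) <> mu R (G j)) /\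
    mu R (G i) @[i --> \oo] --> gamma.

Definition tau (R : realType) : R := (Num.sqrt 5 + 1) / 2.

Definition h (R : realType) (n : nat) : {poly R} :=
  'X^(n.+1) - \sum_(0 <= k < n) 'X^k.

Definition beta (R : realType) (n : nat) : R :=
  maximum [set x : R | 0 < x /\ root (h R n) x].

Definition sqrt_plus_inv (R : realType) (x : R) : R :=
  Num.sqrt x + (Num.sqrt x)^-1.

Definition alpha (R : realType) (n : nat) : R := sqrt_plus_inv (beta R n).

(* Main.v *)
(* By path trees (Godsil), mu(G) is the critical value of a rooted tree, i.e. the
   x at which the ratios r(T) = 1 / (x - sum of the ratios of the children) of
   the branches at the root sum to x.  Write x = t + 1/t; the fixed points of
   r |-> 1 / (x - r) are t and 1/t.
   Upper part: for t^2 > tau choose greedily, along an infinite caterpillar, the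
   number of leaves so that an infinite path could still be attached.  The
   positive solution f of the eigenvector equation is then bounded, since a
   quadratic energy is monotone along it, and this forces the largest matching
   roots of the finite truncations to converge to x (Shearer).  A spine with a
   single leaf gives alpha_n in the same way.
   Lower part (Hoffman): when t^2 < tau, a long path in a tree with critical value
   close to x cannot branch far from its ends.  Along its unbranched middle the
   ratios are attracted by t, but no tree has a ratio close to t unless x is some
   alpha_n.  So the trees with critical values near x have bounded height, there
   are finitely many of them, and x is not a limit point. *)
Require Import Defs.
From HB Require Import structures.
From mathcomp Require Import all_boot all_order all_algebra.
From mathcomp Require Import all_classical all_reals all_analysis.
From mathcomp Require Import ring lra zify.
Import Order.TTheory GRing.Theory Num.Theory.
Import numFieldNormedType.Exports.

Set Implicit Arguments.
Unset Strict Implicit.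
Unset Printing Implicit Defensive.

Local Open Scope classical_set_scope.
Local Open Scope ring_scope.

(** * Matching polynomials of induced subgraphs *)

Section InducedMatchingPoly.
Variables (R : realType) (G : sgraph).
Implicit Types (S : {set G}) (M : {set {set G}}) (u v : G).

(** Induced subgraphs are vertex subsets of the fixed graph [G], so deleting vertices never changes
    the vertex type. *)
Definition mpoly_on S : {poly R} :=
  \sum_(M : {set {set G}} | is_matching M && (finset.cover M \subset S))
    (-1) ^+ #|M| *: 'X^#|(S :\: finset.cover M)%SET|.

Lemma mpoly_onT : mpoly_on [set: G]%SET = matching_poly R G.
Proof.
rewrite /mpoly_on /matching_poly; apply: eq_big => [M|M _].
  by rewrite finset.subsetT andbT.
by rewrite finset.setTD.
Qed.

Lemma edgesP (e : {set G}) v : e \in edges G -> v \in e ->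
  exists2 u, adj v u & e = [set v; u]%SET.
Proof.
move=> /finset.imsetP[[a b] /= ab ->]; rewrite finset.in_set2 => /orP[/eqP->|/eqP->].
  by exists b => //; move: ab; rewrite inE.
exists a; first by rewrite adj_sym; move: ab; rewrite inE.
by rewrite finset.setUC.
Qed.

Lemma edge_adj v u : adj v u -> [set v; u]%SET \in edges G.
Proof. by move=> vu; apply/finset.imsetP; exists (v, u); rewrite ?inE. Qed.

Lemma set2_inj v u u' : [set v; u]%SET = [set v; u']%SET -> u = u'.
Proof.
move=> E; have : u \in [set v; u']%SET by rewrite -E finset.in_set2 eqxx orbT.
rewrite finset.in_set2 => /orP[/eqP uv|/eqP//].
have : u' \in [set v; u]%SET by rewrite E finset.in_set2 eqxx orbT.
by rewrite finset.in_set2 uv orbb => /eqP.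
Qed.

Lemma matching_edge M (e : {set G}) : is_matching M -> e \in M -> e \in edges G.
Proof. by move=> /andP[/fintype.subsetP sub _] /sub. Qed.

Lemma matching_uniq M (e e' : {set G}) v :
  is_matching M -> e \in M -> e' \in M -> v \in e -> v \in e' -> e = e'.
Proof.
move=> /andP[_ /finset.trivIsetP tM] eM e'M ve ve'; apply/eqP/negP => /negP ne.
have := tM _ _ eM e'M ne; rewrite -finset.setI_eq0 => /eqP/finset.setP/(_ v).
by rewrite !inE ve ve'.
Qed.

Lemma matching_sub M M' : is_matching M -> M' \subset M -> is_matching M'.
Proof.
move=> /andP[sM tM] sub; apply/andP; split; first exact: fintype.subset_trans sM.
exact: finset.trivIsetS tM.
Qed.

Lemma mem_cover M (e : {set G}) v : e \in M -> v \in e -> v \in finset.cover M.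
Proof. by move=> eM ve; apply/finset.bigcupP; exists e. Qed.

Lemma cover_setU1 M (e : {set G}) :
  finset.cover (e |: M)%SET = (e :|: finset.cover M)%SET.
Proof.
apply/finset.setP => v; rewrite inE; apply/finset.bigcupP/orP.
  move=> [e']; rewrite !inE => /orP[/eqP->|e'M ve']; first by left.
  by right; apply: mem_cover ve'.
move=> [ve|/finset.bigcupP[e' e'M ve']]; first by exists e; rewrite // !inE eqxx.
by exists e'; rewrite // !inE e'M orbT.
Qed.

Lemma matching_add M v u : is_matching M -> adj v u ->
  v \notin finset.cover M -> u \notin finset.cover M ->
  is_matching ([set v; u] |: M)%SET.
Proof.
move=> mM vu vM uM; apply/andP; split.
  rewrite finset.subUset finset.sub1set edge_adj //=.
  by case/andP: mM.
have disj e : e \in M -> fintype.disjoint (mem [set v; u]%SET) (mem e).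
  move=> eM; rewrite -finset.setI_eq0; apply/eqP/finset.setP => w.
  rewrite !inE; apply/negP => /andP[/orP[/eqP->|/eqP->]] we.
    by move/negP: vM; apply; apply: mem_cover we.
  by move/negP: uM; apply; apply: mem_cover we.
apply/finset.trivIsetP => e e'; rewrite !inE => /orP[/eqP->|eM] /orP[/eqP->|e'M].
- by rewrite eqxx.
- by move=> _; apply: disj.
- by move=> _; rewrite disjoint_sym; apply: disj.
- by case/andP: mM => _ /finset.trivIsetP; apply.
Qed.

(** Matchings are sorted by whether they cover [v] and by the partner [u] of [v]; removing the edge
    [vu] accounts for the sign. *)
Lemma mpoly_on_rec S v : v \in S ->
  mpoly_on S = 'X * mpoly_on (S :\ v)%SET -
    \sum_(u in S | adj v u) mpoly_on (S :\ v :\ u)%SET.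
Proof.
move=> vS; rewrite {1}/mpoly_on (bigID (fun M => v \notin finset.cover M)) /=.
congr (_ + _).
  rewrite /mpoly_on mulr_sumr; apply: eq_big => [M|M /andP[/andP[_ sub] vM]].
    by rewrite -andbA finset.subsetD1.
  rewrite -scalerAr -exprS; congr (_ *: 'X^_).
  rewrite (finset.cardsD1 v) !inE vS vM add1n; congr (_.+1).
  by apply: eq_card => w; rewrite !inE; case: (w == v); rewrite ?andbF.
(* The default [v] only arises for matchings that leave [v] uncovered. *)
pose partner M := odflt v [pick u | ([set v; u]%SET \in M) && adj v u].
have partnerP M : is_matching M -> v \in finset.cover M ->
    ([set v; partner M]%SET \in M) && adj v (partner M).
  move=> mM /finset.bigcupP[e eM ve]; rewrite /partner; case: pickP => //= none.
  have [u vu eE] := edgesP (matching_edge mM eM) ve.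
  by have := none u; rewrite -eE eM vu.
rewrite (partition_big partner (fun u => (u \in S) && adj v u)); last first.
  move=> M /andP[/andP[mM sub]]; rewrite negbK => vM.
  have /andP[pM ->] := partnerP M mM vM; rewrite andbT.
  apply: (fintype.subsetP sub); apply: mem_cover pM _.
  by rewrite !inE eqxx orbT.
rewrite -sumrN; apply: eq_bigr => u /andP[uS vu].
have nvu : v != u by apply/eqP => E; move: vu; rewrite E adj_irrefl.
pose e := [set v; u]%SET.
transitivity (\sum_(M | [&& is_matching M, finset.cover M \subset S & e \in M])
    (-1) ^+ #|M| *: 'X^#|(S :\: finset.cover M)%SET| : {poly R}).
  apply: eq_bigl => M; rewrite negbK.
  case mM: (is_matching M); last by rewrite !andFb.
  case: (finset.cover M \subset S); last by rewrite !andbF.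
  rewrite !andTb; apply/andP/idP => [[vM /eqP pu]|eM].
    by have := partnerP M mM vM; rewrite pu => /andP[].
  have vM : v \in finset.cover M by apply: mem_cover eM _; rewrite !inE eqxx.
  split=> //; apply/eqP; have /andP[pM _] := partnerP M mM vM.
  apply: (@set2_inj v); apply: (@matching_uniq M _ _ v) => //; by rewrite !inE eqxx.
rewrite (reindex_onto (fun M => (e |: M)%SET) (fun M => (M :\ e)%SET)) /=; last first.
  by move=> M /and3P[_ _ eM]; rewrite finset.setD1K.
rewrite /mpoly_on -sumrN; apply: eq_big => [M|M /andP[/and3P[mM sub _] /eqP E]].
  apply/andP/andP.
    move=> [/and3P[mM sub eM] /eqP E].
    have eNM : e \notin M by rewrite -E !inE eqxx.
    have mM' : is_matching M by apply: matching_sub mM _; exact: finset.subsetUr.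
    split=> //; apply/fintype.subsetP => w wM.
    have wS : w \in S.
      by apply: (fintype.subsetP sub); rewrite cover_setU1 inE wM orbT.
    have : w \notin e.
      apply/negP => we; case/finset.bigcupP: wM => e' e'M we'.
      have e'e : e' = e.
        apply: (@matching_uniq _ _ _ w mM _ eM we' we).
        by rewrite !inE e'M orbT.
      by move: eNM; rewrite -e'e e'M.
    by rewrite !inE negb_or => /andP[-> ->].
  move=> [mM sub].
  have vM : v \notin finset.cover M.
    by apply/negP => /(fintype.subsetP sub); rewrite !inE eqxx /= andbF.
  have uM : u \notin finset.cover M.
    by apply/negP => /(fintype.subsetP sub); rewrite !inE eqxx.
  have eM : e \notin M.
    by apply/negP => eM; move/negP: vM; apply; apply: mem_cover eM _; rewrite !inE eqxx.
  split; last by rewrite finset.setU1K.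
  rewrite matching_add //= cover_setU1 finset.subUset finset.setU11 andbT.
  rewrite finset.subUset !finset.sub1set vS uS /=.
  apply: fintype.subset_trans sub _.
  by apply/fintype.subsetP => w; rewrite !inE => /and3P[].
have eM : e \notin M by rewrite -E !inE eqxx.
rewrite finset.cardsU1 eM add1n exprS mulN1r scaleNr; congr (- (_ *: 'X^_)).
rewrite cover_setU1; apply: eq_card => w; rewrite !inE negb_or.
by case: (w == v); case: (w == u); case: (w \in finset.cover M); case: (w \in S).
Qed.

Lemma mpoly_on0 : mpoly_on finset.set0 = 1.
Proof.
rewrite /mpoly_on (big_pred1 (finset.set0 : {set {set G}})).
  by rewrite finset.cards0 expr0 scale1r finset.set0D finset.cards0 expr0.
move=> M; apply/andP/eqP => [[mM]|->].
  rewrite finset.subset0 => /eqP cM; apply/finset.setP => e; rewrite inE.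
  apply/negP => eM; have /finset.imsetP[[a b] /= _ eE] := matching_edge mM eM.
  have : a \in finset.cover M by apply: mem_cover eM _; rewrite eE !inE eqxx.
  by rewrite cM inE.
split; last by rewrite /finset.cover finset.big_set0 finset.sub0set.
apply/andP; split; first exact: finset.sub0set.
by apply/finset.trivIsetP => e; rewrite inE.
Qed.

End InducedMatchingPoly.

(** * The largest matching root *)

(** Induction on the size: one root is factored out and compared with the largest root of the
    quotient. *)
Lemma maximum_root_exists (R : idomainType) (le : rel R) (p : {poly R}) :
  reflexive le -> transitive le -> total le ->
  p != 0 -> (exists x, root p x) ->
  exists2 x, root p x & forall y, root p y -> le y x.
Proof.
move=> lexx tr tot; have [n] := ubnP (size p); elim: n p => // n IH p szp p0 [a].
move=> /factor_theorem[q pE].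
have q0 : q != 0 by apply: contra_neq p0 => q0; rewrite pE q0 mul0r.
have rootpE y : root p y = root q y || (y == a).
  by rewrite pE rootM root_XsubC.
have [[b qb]|noroot] := EM (exists b, root q b); last first.
  exists a => [|y]; first by rewrite rootpE eqxx orbT.
  by rewrite rootpE => /orP[qy|/eqP->//]; case: noroot; exists y.
have /(IH q)[//||x qx xmax] : (size q < n)%N.
  by move: szp; rewrite pE size_Mmonic ?monicXsubC // size_XsubC addn2.
  by exists b.
have [xa|ax] := orP (tot x a).
  exists a => [|y]; first by rewrite rootpE eqxx orbT.
  by rewrite rootpE => /orP[/xmax yx|/eqP->//]; apply: tr xa.
exists x => [|y]; first by rewrite rootpE qx.
by rewrite rootpE => /orP[/xmax|/eqP->].
Qed.

Lemma horner_gt0_of_roots (R : rcfType) (p : {poly R}) (m B : R) :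
  (forall y, B <= y -> 0 < p.[y]) -> (forall y, root p y -> y <= m) ->
  forall y, m < y -> 0 < p.[y].
Proof.
move=> pB pm y my; rewrite ltNge; apply/negP => py.
have yM : y <= Num.max y B by rewrite le_max lexx.
have [|z /andP[yz _] /pm] := @poly_ivt _ p _ _ yM.
  by rewrite py ltW // pB // le_max lexx orbT.
by move=> zm; move: (lt_le_trans my (le_trans yz zm)); rewrite ltxx.
Qed.

Section LargestRoots.
Variables (R : realType) (G : sgraph).
Implicit Types (S : {set G}) (u v : G) (x y : R).
Local Notation P S x := (mpoly_on R S).[x].

Definition largest_root S : R := maximum [set x : R | root (mpoly_on R S) x].

Lemma horner_mpoly_on0 x : P (finset.set0 : {set G}) x = 1.
Proof. by rewrite mpoly_on0 hornerC. Qed.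

Lemma horner_mpoly_on_rec S v x : v \in S ->
  P S x = x * P (S :\ v)%SET x - \sum_(u in S | adj v u) P (S :\ v :\ u)%SET x.
Proof. move=> vS.
rewrite (mpoly_on_rec R vS).
rewrite hornerD hornerN hornerM hornerX; congr (_ - _); exact: horner_sum.
Qed.

Lemma card_setD1 S v : v \in S -> #|S| = (#|(S :\ v)%SET|).+1.
Proof. by move=> vS; rewrite (finset.cardsD1 v) vS. Qed.

Lemma adj_setD1 S v u : u \in S -> adj v u -> u \in (S :\ v)%SET.
Proof.
move=> uS vu; rewrite !inE uS andbT; apply/eqP => E.
by move: vu; rewrite E adj_irrefl.
Qed.

(** By induction each of the at most [#|S|] terms subtracted in the recursion is bounded by
    [P (S :\ v) x], which leaves a factor [x - #|S| >= 1]. This supplies a point above all roots. *)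
Lemma horner_mpoly_on_large S x : #|S|%:R + 1 <= x ->
  0 < P S x /\ forall v, v \in S -> P (S :\ v)%SET x <= P S x.
Proof.
have [n] := ubnP #|S|; elim: n S => // n IH S szS xS.
have step v : v \in S -> P (S :\ v)%SET x <= P S x.
  move=> vS; have cS := card_setD1 vS.
  have szv : (#|(S :\ v)%SET| < n)%N by rewrite cS in szS.
  have xSv : #|(S :\ v)%SET|%:R + 1 <= x.
    by apply: le_trans xS; rewrite cS -natr1; lra.
  have [Pv0 Pv] := IH _ szv xSv.
  have sumle : \sum_(u in S | adj v u) P (S :\ v :\ u)%SET x <=
      #|S|%:R * P (S :\ v)%SET x.
    rewrite -sum1_card natr_sum mulr_suml [leRHS](bigID (adj v)) /=.
    rewrite -[leLHS]addr0; apply: lerD; last first.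
      by apply: sumr_ge0 => u _; rewrite mul1r ltW.
    by apply: ler_sum => u /andP[uS vu]; rewrite mul1r Pv // adj_setD1.
  by rewrite (horner_mpoly_on_rec x vS); nra.
split=> //; have [->|/finset.set0Pn[v vS]] := eqVneq S finset.set0.
  by rewrite horner_mpoly_on0.
apply: lt_le_trans (step v vS).
have cS := card_setD1 vS.
apply: (proj1 (IH _ _ _)); first by rewrite cS in szS.
by apply: le_trans xS; rewrite cS -natr1; lra.
Qed.

Lemma largest_root_set0 : largest_root finset.set0 = 0.
Proof.
by apply: xgetPN => x [/= + _]; rewrite /root horner_mpoly_on0 oner_eq0.
Qed.

(** The claims support each other in one induction. At the largest root [m] of [S :\ v] the first
    term of the recursion vanishes and the subtracted ones are nonnegative, since deleting [u] does
    not raise the largest root. So [P S m <= 0], and [S] has a root at or above [m]. *)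
Lemma largest_rootP S :
  [/\ 0 <= largest_root S, forall y, largest_root S < y -> 0 < P S y,
      S != finset.set0 -> P S (largest_root S) = 0 &
      forall v, v \in S -> largest_root (S :\ v)%SET <= largest_root S].
Proof.
have [n] := ubnP #|S|; elim: n S => // n IH S szS.
have [->|SN0] := eqVneq S finset.set0.
  rewrite largest_root_set0.
  by split=> // y; rewrite ?horner_mpoly_on0 // inE.
have IHv v : v \in S -> (#|(S :\ v)%SET| < n)%N.
  by move=> vS; rewrite (card_setD1 vS) in szS.
have pos y : #|S|%:R + 1 <= y -> 0 < P S y.
  by move=> /horner_mpoly_on_large[].
have rootgt v : v \in S -> exists2 z, root (mpoly_on R S) z & largest_root (S :\ v)%SET <= z.
  move=> vS; set m := largest_root _.
  have [m0 mpos mroot mmono] := IH _ (IHv v vS).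
  have Pm : P S m <= 0.
    rewrite (horner_mpoly_on_rec m vS).
    (* When [S :\ v] is empty its polynomial is 1, but then [m] is the default 0. *)
    have -> : m * P (S :\ v)%SET m = 0.
      have [E|N] := eqVneq (S :\ v)%SET finset.set0; last by rewrite mroot // mulr0.
      by rewrite /m E largest_root_set0 mul0r.
    rewrite sub0r oppr_le0; apply: sumr_ge0 => u /andP[uS vu].
    have uSv := adj_setD1 uS vu.
    have [|_ mpos' mroot' _] := IH (S :\ v :\ u)%SET.
      by apply: leq_trans (IHv v vS); rewrite ltnS (card_setD1 uSv) leqnSn.
    have := mmono u uSv; rewrite le_eqVlt => /orP[/eqP mE|/mpos'/ltW//].
    rewrite /m -mE; have [->|/mroot' ->//] := eqVneq (S :\ v :\ u)%SET finset.set0.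
    by rewrite horner_mpoly_on0.
  have mM : m <= Num.max m (#|S|%:R + 1) by rewrite le_max lexx.
  have [|z /andP[mz _] rz] := @poly_ivt _ (mpoly_on R S) _ _ mM; last by exists z.
  by rewrite Pm ltW // pos // le_max lexx orbT.
have p0 : mpoly_on R S != 0.
  by apply/eqP => p0; have := pos _ (lexx _); rewrite p0 horner0 ltxx.
have [v vS] := finset.set0Pn _ SN0.
have [z rz mz] := rootgt v vS.
have [||||w rw wmax] := @maximum_root_exists _ <=%R (mpoly_on R S) _ _ _ p0.
- exact: lexx.
- exact: le_trans.
- exact: le_total.
- by exists z.
have -> : largest_root S = w by apply: maximumE.
split.
- by have [m0 _ _ _] := IH _ (IHv v vS); apply: le_trans m0 (le_trans mz (wmax _ rz)).
- exact: horner_gt0_of_roots pos wmax.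
- by move=> _; apply/eqP.
- by move=> u /rootgt[z' rz' mz']; apply: le_trans mz' (wmax _ rz').
Qed.

Lemma largest_root_setT : largest_root [set: G]%SET = mu R G.
Proof. by rewrite /largest_root mpoly_onT. Qed.

Lemma largest_root_le S : largest_root S <= mu R G.
Proof.
have [n] := ubnP #|~: S|%SET; elim: n S => // n IH S szS.
have [E|/finset.set0Pn[v]] := eqVneq (~: S)%SET finset.set0.
  by rewrite -(finset.setCK S) E finset.setC0 largest_root_setT.
rewrite inE => vS.
have SE : (S = (v |: S) :\ v)%SET by rewrite finset.setU1K.
have [_ _ _ /(_ v)] := largest_rootP (v |: S)%SET.
rewrite finset.setU11 -SE => /(_ isT) le1; apply: le_trans le1 (IH _ _).
have vC : v \in (~: S)%SET by rewrite inE.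
rewrite (card_setD1 vC) ltnS in szS; apply: leq_ltn_trans szS.
apply: subset_leq_card; apply/fintype.subsetP => w.
by rewrite !inE negb_or.
Qed.

Lemma mu_ge0 : 0 <= mu R G.
Proof. by have [? _ _ _] := largest_rootP [set: G]%SET; rewrite -largest_root_setT. Qed.

Lemma horner_mpoly_on_gt0 S y : mu R G < y -> 0 < P S y.
Proof.
have [_ pos _ _] := largest_rootP S.
by move=> muy; apply: pos; apply: le_lt_trans muy; exact: largest_root_le.
Qed.

Lemma horner_mpoly_on_ge0 S : 0 <= P S (mu R G).
Proof.
have [_ pos rt _] := largest_rootP S.
have := largest_root_le S; rewrite le_eqVlt => /orP[/eqP <-|/pos/ltW//].
have [->|/rt->//] := eqVneq S finset.set0.
by rewrite horner_mpoly_on0.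
Qed.

Lemma horner_mu : [set: G]%SET != finset.set0 -> P [set: G]%SET (mu R G) = 0.
Proof.
by have [_ _ rt _] := largest_rootP [set: G]%SET; rewrite -largest_root_setT.
Qed.

Lemma mu_lt x : 0 < x -> (forall y, x <= y -> 0 < P [set: G]%SET y) -> mu R G < x.
Proof.
move=> x0 Px.
have [E|/horner_mu mu0] := eqVneq [set: G]%SET finset.set0.
  by rewrite -largest_root_setT E largest_root_set0.
by rewrite ltNge; apply/negP => /Px; rewrite mu0 ltxx.
Qed.

End LargestRoots.

(** * Rooted trees and path trees *)

(** Distinctness comes from choosing each graph strictly nearer to [gamma] than the one before.
    Conversely, of two consecutive terms at most one has the value [gamma]. *)
Lemma limit_pointP (R : realType) (gamma : R) :
  is_limit_point gamma <->
  forall e, 0 < e -> exists2 G : sgraph, mu R G != gamma & `|mu R G - gamma| < e.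
Proof.
split=> [[G [dist cvG]] e e0|H].
  have /cvgrPdist_lt/(_ e e0)[N _ HN] := cvG.
  have close i : (N <= i)%N -> `|mu R (G i) - gamma| < e.
    by move=> Ni; rewrite distrC; apply: HN.
  have [E|NE] := eqVneq (mu R (G N)) gamma; last by exists (G N) => //; exact: close.
  exists (G N.+1); last exact: close.
  by rewrite -E; apply/eqP/dist/eqP; rewrite gtn_eqF.
have [G0 _ _] := H 1 ltr01.
have /choice[f Hf] : forall e : R, exists G : sgraph,
    0 < e -> mu R G != gamma /\ `|mu R G - gamma| < e.
  move=> e; have [e0|e0] := ltP 0 e; last by exists G0.
  by have [G G1 G2] := H e e0; exists G.
pose g := fix g n := if n is m.+1
  then f (Num.min `|mu R (g m) - gamma| m.+1%:R^-1) else f 1.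
have gS n : g n.+1 = f (Num.min `|mu R (g n) - gamma| n.+1%:R^-1) by [].
have neq n : mu R (g n) != gamma.
  elim: n => [|n IH]; first by have [] := Hf 1 ltr01.
  rewrite gS; have [|//] := Hf (Num.min `|mu R (g n) - gamma| n.+1%:R^-1).
  by rewrite lt_min normr_gt0 subr_eq0 IH invr_gt0 ltr0n.
have close n : `|mu R (g n.+1) - gamma| < Num.min `|mu R (g n) - gamma| n.+1%:R^-1.
  rewrite gS; have [|//] := Hf (Num.min `|mu R (g n) - gamma| n.+1%:R^-1).
  by rewrite lt_min normr_gt0 subr_eq0 neq invr_gt0 ltr0n.
have decr i j : (i < j)%N -> `|mu R (g j) - gamma| < `|mu R (g i) - gamma|.
  elim: j => // j IH; rewrite ltnS leq_eqVlt => /predU1P[->|/IH].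
    by have := close j; rewrite lt_min => /andP[].
  by apply: lt_trans; have := close j; rewrite lt_min => /andP[].
exists g; split=> [i j ij E|].
  have : (i != j) by apply/eqP.
  by rewrite neq_ltn => /orP[] /decr; rewrite E ltxx.
apply/cvgrPdist_lt => e e0.
have [N _ HN] := near_infty_natSinv_lt (PosNum e0).
exists N.+1 => // -[//|n] /= Nn; rewrite distrC.
apply: lt_trans (HN n Nn).
by have := close n; rewrite lt_min => /andP[].
Qed.

(* Rose trees, i.e. rooted trees.  If no ratio vanishes, [ratio x T] is the
   quotient of the matching polynomials at x of T minus its root and of T. *)
Inductive tree := Node of seq tree.

Lemma tree_seq_ind (P : tree -> Prop) (Q : seq tree -> Prop) :
  Q [::] -> (forall c cs, P c -> Q cs -> Q (c :: cs)) ->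
  (forall cs, Q cs -> P (Node cs)) -> (forall T, P T) /\ (forall cs, Q cs).
Proof.
move=> Q0 QS PN.
have PT : forall T, P T.
  by fix IH 1 => -[cs]; apply: PN; elim: cs => [//|c cs]; apply: QS; apply: IH.
by split=> //; elim=> [//|c cs]; apply: QS; apply: PT.
Qed.

Section Trees.
Variable R : realType.
Implicit Types (x y : R) (T : tree) (cs : seq tree).

Fixpoint ratio x T : R :=
  let: Node cs := T in (x - foldr (fun c z => ratio x c + z) 0 cs)^-1.

Definition weight x cs : R := \sum_(c <- cs) ratio x c.

(** All denominators occurring in [ratio] are positive, which amounts to [x] lying above the largest
    matching root of [T]. In [critical] the denominator at the root vanishes instead. *)
Fixpoint good x T : bool :=
  let: Node cs := T in all (good x) cs && (weight x cs < x).

Definition critical x T : bool :=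
  let: Node cs := T in all (good x) cs && (weight x cs == x).

Lemma ratioE x cs : ratio x (Node cs) = (x - weight x cs)^-1.
Proof. by rewrite /weight unlock. Qed.

Lemma weight_nil x : weight x [::] = 0.
Proof. by rewrite /weight big_nil. Qed.

Lemma weight_cons x c cs : weight x (c :: cs) = ratio x c + weight x cs.
Proof. by rewrite /weight big_cons. Qed.

Lemma weight_cat x cs cs' : weight x (cs ++ cs') = weight x cs + weight x cs'.
Proof. by rewrite /weight big_cat. Qed.

Lemma ratio_gt0 x T : good x T -> 0 < ratio x T.
Proof. by case: T => cs; rewrite ratioE invr_gt0 subr_gt0 => /andP[]. Qed.

Lemma weight_ge0 x cs : all (good x) cs -> 0 <= weight x cs.
Proof.
elim: cs => [|c cs IH] /=; first by rewrite weight_nil.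
by rewrite weight_cons => /andP[/ratio_gt0/ltW c0 /IH]; apply: addr_ge0.
Qed.

Lemma good_gt0 x T : good x T -> 0 < x.
Proof. by case: T => cs /andP[/weight_ge0 cs0]; apply: le_lt_trans. Qed.

Lemma ratio_ge x T : good x T -> x^-1 <= ratio x T.
Proof.
move=> gT; have x0 := good_gt0 gT; move: gT; case: T => cs /andP[/weight_ge0 cs0 csx].
by rewrite ratioE lef_pV2 ?posrE ?subr_gt0 // gerBl.
Qed.

Lemma weight_ge_size x cs : all (good x) cs -> (size cs)%:R / x <= weight x cs.
Proof.
elim: cs => [|c cs IH] /=; first by rewrite weight_nil mul0r.
move=> /andP[/ratio_ge gc /IH gcs]; rewrite weight_cons -natr1 mulrDl mul1r addrC.
exact: lerD.
Qed.

(** Raising [x] increases every denominator. The bound for lists is weak because of the empty one.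
    Uniqueness of the critical value follows. *)
Lemma good_lt x y : x < y ->
  (forall T, good x T -> good y T /\ ratio y T < ratio x T) /\
  (forall cs, all (good x) cs -> all (good y) cs /\ weight y cs <= weight x cs).
Proof.
move=> xy; apply: tree_seq_ind => [|c cs IHc IHcs|cs IHcs] /=.
- by rewrite !weight_nil.
- move=> /andP[/IHc[-> rc] /IHcs[-> wcs]]; split=> //.
  by rewrite !weight_cons lerD // ltW.
- move=> /andP[/IHcs[-> wcs] wx]; split; first by rewrite /=; lra.
  rewrite -!/(ratio _ (Node _)) !ratioE ltf_pV2 ?posrE ?subr_gt0 //; lra.
Qed.

Lemma critical_uniq x y T : critical x T -> critical y T -> x = y.
Proof.
wlog suff lt_false : x y / critical x T -> critical y T -> x < y -> False.
  by move=> cx cy; case: (ltgtP x y) => // [/lt_false|/lt_false]; case.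
case: T => cs /andP[gx /eqP wx] /andP[gy /eqP wy] xy.
by have [_ /(_ cs gx)[_]] := good_lt xy; rewrite wx wy leNgt xy.
Qed.

Fixpoint deep (n : nat) T : bool :=
  if n is m.+1 then let: Node cs := T in has (deep m) cs else true.

Fixpoint narrow (k : nat) T : bool :=
  let: Node cs := T in (size cs <= k)%N && all (narrow k) cs.

(** Every ratio is at least [x^-1], so there are at most [x ^+ 2 <= 9] children. *)
Lemma good_size x cs : all (good x) cs -> weight x cs <= x -> x <= 3 ->
  (size cs <= 9)%N.
Proof.
case: cs => [//|c cs] gcs wx x3.
have x0 : 0 < x by move: gcs => /= /andP[/good_gt0].
have := le_trans (weight_ge_size gcs) wx.
rewrite ler_pdivrMr // => szx.
by rewrite -(ler_nat R); nra.
Qed.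

Lemma good_narrow x T : x <= 3 -> good x T -> narrow 9 T.
Proof.
move=> x3; move: T; suff [] : (forall T, good x T -> narrow 9 T) /\
  (forall cs, all (good x) cs -> all (narrow 9) cs) by [].
apply: tree_seq_ind => [//|c cs IHc IHcs|cs IHcs] /=.
  by move=> /andP[/IHc-> /IHcs].
by move=> /andP[gcs /ltW wx]; rewrite (good_size gcs) // IHcs.
Qed.

Lemma finite_seq_le (A : Type) (E : set A) (k : nat) : finite_set E ->
  finite_set [set s : seq A | (size s <= k)%N /\ List.Forall E s].
Proof.
move=> finE; elim: k => [|k IH].
  apply: sub_finite_set (finite_set1 [::]) => -[//|a s] [].
  by rewrite ltn0.
have finI := finite_image2 cons finE IH.
apply: sub_finite_set (_ : finite_set ([set [::]] `|` _)); last first.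
  rewrite finite_setU; split; [exact: finite_set1|exact: finI].
move=> [|a s] /= [szs Es]; [by left|right].
by inversion_clear Es; exists a => //; exists s.
Qed.

Lemma finite_shallow (n k : nat) : finite_set [set T | ~~ deep n T /\ narrow k T].
Proof.
elim: n => [|n IH]; first by apply: sub_finite_set (finite_set0 _) => T [].
apply: sub_finite_set (finite_image Node (finite_seq_le k IH)) => -[cs] /= [].
rewrite -all_predC => dcs /andP[szcs ncs]; exists cs => //; split=> //.
elim: cs {szcs} dcs ncs => [|c cs IHcs] /=; first by constructor.
by move=> /andP[? ?] /andP[? ?]; constructor; [split|exact: IHcs].
Qed.

End Trees.

(** * Godsil's path trees *)

Section PathTree.
Variables (R : realType) (G : sgraph).
Implicit Types (S : {set G}) (u v : G) (x y : R).
Local Notation P S x := (mpoly_on R S).[x].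

Lemma path_trees S v x (us : seq G) :
  (forall u, adj v u -> u \in S ->
    exists T, good x T /\ ratio x T = P (S :\ v :\ u)%SET x / P (S :\ v)%SET x) ->
  exists2 cs, all (good x) cs & weight x cs =
    \sum_(u <- us | (u \in S) && adj v u) P (S :\ v :\ u)%SET x / P (S :\ v)%SET x.
Proof.
move=> H; elim: us => [|u us [cs gcs wcs]].
  by exists [::] => //; rewrite weight_nil big_nil.
rewrite big_cons; case: ifP => [/andP[uS vu]|_]; last by exists cs.
have [T [gT rT]] := H u vu uS.
by exists (T :: cs); rewrite /= ?gT // weight_cons rT wcs.
Qed.

(** The recursion for [P S x], divided by [P (S :\ v) x], is the one defining [ratio]: the branches
    at the root are the trees of [S :\ v] rooted at the neighbours [u] of [v]. Positivity on all
    subsets makes every branch good. *)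
Lemma path_tree S v x : v \in S ->
  (forall S', S' \subset S -> 0 < P S' x) ->
  exists T, good x T /\ ratio x T = P (S :\ v)%SET x / P S x.
Proof.
have [n] := ubnP #|S|; elim: n S v => // n IH S v szS vS pos.
have posv : 0 < P (S :\ v)%SET x by apply: pos; exact: finset.subD1set.
have [|cs gcs wcs] := @path_trees S v x (index_enum G).
  move=> u vu uS; apply: IH; first by rewrite (card_setD1 vS) in szS.
    exact: adj_setD1.
  by move=> S' sub; apply: pos; apply: fintype.subset_trans sub (finset.subD1set _ _).
have PS : P S x = (x - weight x cs) * P (S :\ v)%SET x.
  by rewrite (horner_mpoly_on_rec x vS) mulrBl wcs -mulr_suml divfK // gt_eqF.
have PS0 := pos S (subxx _).
have wx : weight x cs < x.
  by rewrite -subr_gt0 -(pmulr_lgt0 _ posv) -PS.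
exists (Node cs); split; first by rewrite /= gcs.
rewrite ratioE PS invfM mulrCA divff ?mulr1 // gt_eqF //.
Qed.

Lemma critical_tree : exists T, critical (mu R G) T.
Proof.
set x := mu R G.
(* The value 0 of the empty graph is the critical value of the one-vertex tree. *)
have [G0|G0] := eqVneq [set: G]%SET finset.set0.
  exists (Node [::]); rewrite /= weight_nil /x.
  by rewrite -largest_root_setT G0 largest_root_set0.
pose Q S := P S x == 0.
have QT : Q [set: G]%SET by apply/eqP; exact: horner_mu.
(* Polynomials of proper subsets may vanish at [x] too; below a minimal zero set they are all
   positive, so the branches are good. *)
have [S /finset.minsetP[/eqP PS minS] _] := finset.minset_exists QT.
have pos S' : S' \proper S -> 0 < P S' x.
  move=> /fintype.properP[sub [w wS wS']].
  rewrite lt_neqAle horner_mpoly_on_ge0 andbT eq_sym; apply/negP => /minS.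
  by move=> /(_ sub) E; rewrite E wS in wS'.
have [S0|/finset.set0Pn[v vS]] := eqVneq S finset.set0.
  by move/eqP: PS; rewrite S0 horner_mpoly_on0 oner_eq0.
have pv : (S :\ v)%SET \proper S by exact: finset.properD1.
have [|cs gcs wcs] := @path_trees S v x (index_enum G).
  move=> u vu uS; apply: path_tree; first exact: adj_setD1.
  by move=> S' sub; apply: pos; exact: sub_proper_trans sub pv.
exists (Node cs); rewrite /= gcs /=.
have : P S x = (x - weight x cs) * P (S :\ v)%SET x.
  rewrite (horner_mpoly_on_rec x vS) mulrBl wcs -mulr_suml divfK // gt_eqF //.
  exact: pos.
by rewrite PS => /esym/eqP; rewrite mulf_eq0 subr_eq0 eq_sym (gt_eqF (pos _ pv)) orbF.
Qed.

End PathTree.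

(** * Caterpillars *)

Section CaterpillarGraph.
Variables (n : nat) (a : nat -> nat).

(** The pair (i, 0) is the i-th spine vertex; the pairs (i, j) with j > 0 are the [a i] leaves
    attached to it. *)
Definition cat_vertex := {i : 'I_n & 'I_(a i).+1}.
HB.instance Definition _ := Finite.on cat_vertex.

Definition spine_pos (u : cat_vertex) : nat := tag u.
Definition leaf_pos (u : cat_vertex) : nat := tagged u.

Definition cat_adj : rel cat_vertex := fun u w =>
  if spine_pos u == spine_pos w then (leaf_pos u == 0)%N (+) (leaf_pos w == 0)%N
  else [&& (leaf_pos u == 0)%N, (leaf_pos w == 0)%N &
    (spine_pos u == (spine_pos w).+1) || (spine_pos w == (spine_pos u).+1)].

Lemma cat_adj_sym : symmetric cat_adj.
Proof.
move=> u w; rewrite /cat_adj eq_sym addbC orbC.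
by case: ifP => // _; rewrite andbCA.
Qed.

Lemma cat_adj_irrefl : irreflexive cat_adj.
Proof. by move=> u; rewrite /cat_adj eqxx addbb. Qed.

Definition caterpillar := SGraph cat_adj_sym cat_adj_irrefl.

End CaterpillarGraph.

Section CaterpillarRatio.
Variables (R : realType) (a : nat -> nat).
Implicit Types x y : R.

(* The quotient of the matching polynomials at x of the caterpillar on the
   first k.+1 spine vertices and of the same graph without its last spine
   vertex. *)
Fixpoint cat_ratio x (k : nat) : R :=
  x - (a k)%:R / x - (if k is j.+1 then (cat_ratio x j)^-1 else 0).

Variable n : nat.
Let V := cat_vertex n a.
Let G := caterpillar n a.
Local Notation P S x := (@mpoly_on R G S).[x].

Lemma cat_vertexP (u w : V) :
  spine_pos u = spine_pos w -> leaf_pos u = leaf_pos w -> u = w.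
Proof.
case: u w => [i j] [i' j']; rewrite /spine_pos /leaf_pos /= => /val_inj ii'.
by case: i' / ii' j' => j' /val_inj ->.
Qed.

Lemma sum_leaves (v : V) x : leaf_pos v = 0%N ->
  \sum_(u : V | (spine_pos u == spine_pos v) && (leaf_pos u != 0)%N) x^-1 =
  (a (spine_pos v))%:R / x.
Proof.
move=> v0; pose i : 'I_n := tag v.
pose f (j : 'I_(a i)) : V := Tagged (fun i : 'I_n => 'I_(a i).+1) (lift ord0 j).
have finj : injective f.
  move=> j j' /(congr1 (@leaf_pos n a)); rewrite /leaf_pos /= /bump !add1n.
  by move=> [] /val_inj.
rewrite sumr_const mulr_natl; congr (_ *+ _).
rewrite -[RHS](card_ord (a i)) -(card_codom finj); apply: eq_card => u.
rewrite [LHS]unfold_in; apply/andP/codomP => [[/eqP us u0]|[j ->]]; last first.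
  by rewrite /spine_pos /leaf_pos /= eqxx.
have u1 : ((leaf_pos u).-1 < a i)%N.
  have := ltn_ord (tagged u); rewrite -/(leaf_pos u) -/(spine_pos u) us.
  by rewrite ltnS; case: (leaf_pos u) u0.
exists (Ordinal u1); apply: cat_vertexP => //.
by rewrite {2}/leaf_pos /= /bump add1n prednK // lt0n.
Qed.

(** Whatever [S] contains beyond position [k] is not adjacent to [v] and stays in both polynomials;
    this freedom lets the induction hypothesis be applied to [S :\ v]. *)
Lemma cat_ratio_horner x k (S : {set G}) (v : G) : x != 0 ->
  (forall j, (j < k)%N -> cat_ratio x j != 0) ->
  spine_pos v = k -> leaf_pos v = 0%N ->
  (forall u : G, (spine_pos u <= k)%N -> u \in S) ->
  (forall u : G, spine_pos u = k.+1 -> leaf_pos u = 0%N -> u \notin S) ->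
  P S x = cat_ratio x k * P (S :\ v)%SET x.
Proof.
move=> x0; elim/ltn_ind: k S v => k IH S v r0 vk vl Sk SkS.
pose w := if k is j.+1 then (cat_ratio x j)^-1 else 0.
have vS : v \in S by apply: Sk; rewrite vk.
(* A leaf at [v] is isolated once [v] is removed and contributes [x^-1]; the preceding spine vertex
   contributes the inverse of its own ratio. *)
have termE u : (u \in S) && adj v u ->
    P (S :\ v :\ u)%SET x = (if spine_pos u == k then x^-1 else w) * P (S :\ v)%SET x.
  move=> /andP[uS vu]; have uSv := adj_setD1 uS vu.
  case: ifP => [/eqP uk|uk].
    rewrite (horner_mpoly_on_rec x uSv) big_pred0 ?subr0 ?mulKf // => z.
    apply/negP => /andP[]; rewrite !inE => /andP[zv _].
    move: vu; rewrite /adj /= /cat_adj vk uk eqxx vl /= => ul.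
    case: ifP => [/eqP zk|_]; last by rewrite (negPf ul).
    rewrite (negPf ul) => /eqP zl; case/eqP: zv; apply: cat_vertexP.
      by rewrite vk.
    by rewrite vl zl.
  move: vu; rewrite /adj /= /cat_adj vk eq_sym uk => /and3P[_ /eqP ul ku].
  have {}ku : k = (spine_pos u).+1.
    case/orP: ku => /eqP // ku; have := SkS u ku ul.
    by rewrite uS.
  have r_neq0 : cat_ratio x (spine_pos u) != 0 by apply: r0; rewrite ku.
  rewrite /w ku; rewrite (IH (spine_pos u) _ (S :\ v)%SET u) ?mulKf //.
  - by rewrite ku.
  - by move=> j ju; apply: r0; rewrite ku ltnS ltnW.
  - move=> z zu; rewrite !inE Sk ?andbT; last by rewrite ku ltnW.
    by apply/eqP => zv; move: zu; rewrite zv vk ku ltnn.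
  - move=> z zu zl; rewrite !inE negb_and negbK; apply/orP; left.
    by apply/eqP/cat_vertexP; rewrite ?vk ?ku ?vl.
rewrite (horner_mpoly_on_rec x vS) (eq_bigr _ termE) -mulr_suml -mulrBl.
congr (_ * _); rewrite (bigID (fun u : G => spine_pos u == k)) /=.
have -> : cat_ratio x k = x - (a k)%:R / x - w by rewrite /w; case: (k).
rewrite opprD addrA; congr (_ - _ - _).
  rewrite -vk -(sum_leaves x vl); apply: eq_big => [u|u /andP[_ ->]//].
  rewrite [LHS]andbC; case uv: (spine_pos u == spine_pos v) => //=.
  by rewrite Sk ?(eqP uv) ?vk //= /cat_adj eq_sym uv vl.
transitivity (\sum_(u in S | adj v u && (spine_pos u != k)) w).
  by apply: eq_big => [u|u /andP[_ /negPf->]//]; rewrite andbA.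
rewrite /w; case: k => [|j] in vk Sk SkS IH r0 w termE *.
  apply: big_pred0 => u; apply/negP => /and3P[uS + uk].
  rewrite /= /cat_adj vk eq_sym (negPf uk) => /and3P[_ /eqP ul].
  rewrite eq_sym /= => /eqP u1.
  by have := SkS u u1 ul; rewrite uS.
have jn : (j < n)%N by rewrite ltnW // -vk; exact: (ltn_ord (tag v)).
pose z : G := Tagged (fun i : 'I_n => 'I_(a i).+1) (ord0 : 'I_(a (Ordinal jn)).+1).
rewrite (big_pred1 z) // => u; apply/and3P/eqP => [[uS + uk]|->].
  rewrite /= /cat_adj vk eq_sym (negPf uk) => /and3P[_ /eqP ul /orP[|]].
    by rewrite eqSS => /eqP ju; apply: cat_vertexP.
  by move=> /eqP u1; have := SkS u u1 ul; rewrite uS.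
split; first by apply: Sk; exact: leqnSn.
  by rewrite /= /cat_adj vk vl /spine_pos /leaf_pos /= gtn_eqF // eqxx.
by rewrite /spine_pos /= ltn_eqF.
Qed.

Lemma cat_ratio_gt0 y : mu R G < y -> forall k, (k < n)%N -> 0 < cat_ratio y k.
Proof.
move=> muy; have y0 : y != 0 by rewrite gt_eqF // (le_lt_trans (mu_ge0 R G)).
elim/ltn_ind => k IH kn.
pose v : G := Tagged (fun i : 'I_n => 'I_(a i).+1) (ord0 : 'I_(a (Ordinal kn)).+1).
pose S : {set G} := [set u : G | spine_pos u <= k]%SET%N.
have := horner_mpoly_on_gt0 S muy.
rewrite (@cat_ratio_horner y k S v) //.
- by rewrite pmulr_lgt0 // horner_mpoly_on_gt0.
- by move=> j jk; rewrite gt_eqF // IH // (ltn_trans jk).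
- by move=> u uk; rewrite inE.
- by move=> u uk _; rewrite inE uk ltnn.
Qed.

Lemma cat_ratio_le x y k : 0 < x -> x <= y ->
  (forall j, (j < k)%N -> 0 < cat_ratio x j) -> cat_ratio x k <= cat_ratio y k.
Proof.
move=> x0 xy; have y0 : 0 < y := lt_le_trans x0 xy.
have leV (c : R) : 0 <= c -> c / y <= c / x.
  by move=> c0; apply: ler_wpM2l => //; rewrite lef_pV2.
elim: k => [|k IH] r0 /=; have := leV _ (ler0n R (a _)).
  by move=> /(_ 0%N) h; lra.
have rk : cat_ratio x k <= cat_ratio y k.
  by apply: IH => j jk; apply: r0; rewrite ltnS ltnW.
have rx : 0 < cat_ratio x k by apply: r0.
have : (cat_ratio y k)^-1 <= (cat_ratio x k)^-1.
  by rewrite lef_pV2 // posrE // (lt_le_trans rx).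
by move=> h /(_ k.+1) h'; lra.
Qed.

Lemma horner_independent x (S : {set G}) :
  (forall u w, u \in S -> w \in S -> ~~ adj u w) -> P S x = x ^+ #|S|.
Proof.
have [m] := ubnP #|S|; elim: m S => // m IH S szS indep.
have [->|/finset.set0Pn[v vS]] := eqVneq S finset.set0.
  by rewrite horner_mpoly_on0 finset.cards0.
rewrite (horner_mpoly_on_rec x vS) big_pred0 ?subr0; last first.
  by move=> u; apply/negP => /andP[uS]; apply/negP/indep.
rewrite (card_setD1 vS) exprS IH //; first by rewrite (card_setD1 vS) in szS.
by move=> u w; rewrite !inE => /andP[_ uS] /andP[_ wS]; apply: indep.
Qed.

Lemma horner_caterpillar_gt0 y : 0 < y ->
  (forall k, (k < n)%N -> 0 < cat_ratio y k) -> 0 < P [set: G]%SET y.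
Proof.
move=> y0 r0.
(* The spine is peeled off from its end; [W 0] consists of the leaves alone, which are
   independent. *)
pose W k : {set G} := [set u : G | (leaf_pos u != 0) || (spine_pos u < k)]%SET%N.
have -> : [set: G]%SET = W n.
  by apply/finset.setP => u; rewrite !inE /spine_pos ltn_ord orbT.
suff : forall k, (k <= n)%N -> 0 < P (W k) y by apply.
elim=> [_|k IH kn].
  rewrite horner_independent ?exprn_gt0 // => u w.
  rewrite !inE !ltn0 !orbF => ul wl.
  by rewrite /= /cat_adj (negPf ul) (negPf wl); case: ifP.
pose v : G := Tagged (fun i : 'I_n => 'I_(a i).+1) (ord0 : 'I_(a (Ordinal kn)).+1).
have -> : P (W k.+1) y = cat_ratio y k * P (W k.+1 :\ v)%SET y.
  apply: cat_ratio_horner => //; first by rewrite gt_eqF.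
  - by move=> j jk; rewrite gt_eqF // r0 // (ltn_trans jk).
  - by move=> u uk; rewrite inE ltnS uk orbT.
  - by move=> u uk ul; rewrite inE ul uk ltnn.
rewrite mulr_gt0 ?r0 //.
suff -> : (W k.+1 :\ v)%SET = W k by apply: IH; exact: ltnW.
apply/finset.setP => u; rewrite !inE ltnS leq_eqVlt.
have [->|uv] := eqVneq u v; first by rewrite /spine_pos /leaf_pos /= ltnn.
case ul: (leaf_pos u == 0)%N => //=.
case uk: (spine_pos u == k) => //=.
by case/eqP: uv; apply: cat_vertexP; [rewrite (eqP uk)|rewrite (eqP ul)].
Qed.

Lemma mu_caterpillar_lt x : 0 < x ->
  (forall k, (k < n)%N -> 0 < cat_ratio x k) -> mu R G < x.
Proof.
move=> x0 r0; apply: mu_lt => // y xy.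
apply: horner_caterpillar_gt0 => [|k kn]; first exact: lt_le_trans xy.
apply: lt_le_trans (r0 k kn) (cat_ratio_le x0 xy _) => j jk.
by apply: r0; exact: ltn_trans kn.
Qed.

End CaterpillarRatio.

(* If y < x is above the roots of all truncations, their ratios at y are positive, and
   comparing them with the ratios at x bounds sum_(j <= k) f_j^2 by a multiple of
   f_k * f_(k+1), where f_k is the product of the first k ratios at x.  Bounded f
   excludes this. *)
Lemma caterpillar_limit_point (R : realType) (a : nat -> nat) (x C : R) :
  0 < x -> (forall k, 0 < cat_ratio a x k) ->
  (forall k, \prod_(j < k) cat_ratio a x j <= C) -> is_limit_point x.
Proof.
move=> x0 r0; set f := fun k => \prod_(j < k) cat_ratio a x j => fC.
have f0 k : 0 < f k by apply: prodr_gt0.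
have fS k : f k.+1 = cat_ratio a x k * f k by rewrite /f big_ord_recr mulrC.
apply/limit_pointP => e e0; apply: contrapT => noG.
have far n : mu R (caterpillar n a) <= x - e.
  rewrite leNgt; apply/negP => mux; apply: noG; exists (caterpillar n a).
    by rewrite lt_eqF // mu_caterpillar_lt.
  rewrite ltr_norml; have := @mu_caterpillar_lt R a n x x0 (fun k _ => r0 k); lra.
(* All truncations have their largest root at most [x - e], so [y] lies strictly between these roots
   and [x]. *)
pose y := x - e / 2.
have y0 : 0 < y by have := le_trans (mu_ge0 R _) (far 0%N); rewrite /y; lra.
have ry0 k : 0 < cat_ratio a y k.
  by apply: (@cat_ratio_gt0 R a k.+1) => //; apply: le_lt_trans (far _) _; rewrite /y; lra.
pose d k := cat_ratio a x k - cat_ratio a y k.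
have yx : y <= x by rewrite /y; lra.
have dE k : (x - y) * \sum_(j < k.+1) f j ^+ 2 <= d k * f k ^+ 2.
  have leV (c : R) : 0 <= c -> c / x <= c / y.
    by move=> c0; apply: ler_wpM2l => //; rewrite lef_pV2.
  elim: k => [|k IH].
    rewrite big_ord1 ler_wpM2r ?sqr_ge0 // /d /=.
    by have := leV _ (ler0n R (a 0%N)); lra.
  rewrite big_ord_recr mulrDr /=; set s := \sum_(i < _) _ in IH *.
  (* The leaf terms favour the inequality, and since ratios at [y] are at most those at [x], the
     mixed product of ratios can be replaced by a square, which [f k.+1 ^+ 2] absorbs. *)
  have dk : x - y + d k / cat_ratio a x k ^+ 2 <= d k.+1.
    have -> : d k.+1 = x - y + ((a k.+1)%:R / y - (a k.+1)%:R / x) +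
        ((cat_ratio a y k)^-1 - (cat_ratio a x k)^-1) by rewrite /d /=; ring.
    have -> : (cat_ratio a y k)^-1 - (cat_ratio a x k)^-1 =
        d k / (cat_ratio a x k * cat_ratio a y k).
      by rewrite /d; field; rewrite !gt_eqF // ry0 r0.
    have dk0 : 0 <= d k by rewrite subr_ge0 (@cat_ratio_le R a y x).
    have : d k / cat_ratio a x k ^+ 2 <= d k / (cat_ratio a x k * cat_ratio a y k).
      apply: ler_wpM2l => //; rewrite lef_pV2 ?posrE ?mulr_gt0 ?exprn_gt0 //.
      by rewrite expr2 ler_pM2l // -subr_ge0.
    by have := leV _ (ler0n R (a k.+1)); lra.
  apply: le_trans (ler_wpM2r (sqr_ge0 (f k.+1)) dk).
  rewrite [leRHS]mulrDl [leLHS]addrC lerD2l; apply: le_trans IH _; rewrite fS exprMn.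
  by rewrite [leRHS]mulrA divfK // expf_neq0 // gt_eqF.
have C0 : 0 < C := lt_le_trans (f0 0%N) (fC 0%N).
have fprod k : (x - y) * \sum_(j < k.+1) f j ^+ 2 <= f k.+1 * f k.
  apply: le_trans (dE k) _; rewrite fS expr2 mulrA ler_pM2r // ler_pM2r //.
  by rewrite /d gerBl ltW.
have xy0 : 0 < x - y by rewrite /y; lra.
have flow k : (x - y) / C <= f k.
  rewrite ler_pdivrMr //.
  have : (x - y) * 1 <= (x - y) * \sum_(j < k.+1) f j ^+ 2.
    rewrite ler_pM2l // big_ord_recl /= {1}/f big_ord0 expr1n lerDl.
    by apply: sumr_ge0 => j _; exact: sqr_ge0.
  rewrite mulr1 => h; apply: le_trans h (le_trans (fprod k) _).
  by rewrite mulrC ler_pM2l ?f0 //; exact: fC.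
(* Each [f j] is at least [(x - y) / C], so the sum of squares grows linearly while [f k.+1 * f k]
   stays below [C ^+ 2]. *)
pose c := (x - y) * ((x - y) / C) ^+ 2.
have c0 : 0 < c by rewrite mulr_gt0 // exprn_gt0 // divr_gt0.
have bnd k : k.+1%:R * c <= C ^+ 2.
  apply: le_trans (_ : f k.+1 * f k <= _); last first.
    by rewrite expr2 ler_pM ?(ltW (f0 _)) //; exact: fC.
  apply: le_trans (fprod k); rewrite /c mulrCA ler_pM2l //.
  rewrite mulr_natl -[X in _ *+ X]card_ord -sumr_const; apply: ler_sum => j _.
  by rewrite lerXn2r ?nnegrE ?(ltW (f0 _)) ?(ltW (divr_gt0 xy0 C0)) ?flow.
have [k kc] : exists k : nat, C ^+ 2 / c < k%:R.
  by exists (Num.truncn (C ^+ 2 / c)).+1; rewrite truncnS_gt.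
have := bnd k; rewrite leNgt => /negP; apply.
rewrite -ltr_pdivrMr // (lt_trans kc) // ltr_nat //.
Qed.

(** * The numbers beta_n and alpha_n *)

Section Beta.
Variable R : realType.
Implicit Types (u v x t : R) (n k : nat).

Lemma horner_h0 u : (h R 0).[u] = u.
Proof. by rewrite /h big_geq // subr0 hornerXn expr1. Qed.

Lemma horner_hE n u : (h R n).[u] = u ^+ n.+1 - \sum_(k < n) u ^+ k.
Proof.
rewrite /h big_mkord hornerD hornerN hornerXn horner_sum; congr (_ - _).
by apply: eq_bigr => k _; rewrite hornerXn.
Qed.

Lemma horner_hS n u : (h R n.+1).[u] = u * (h R n).[u] - 1.
Proof.
rewrite !horner_hE big_ord_recl /= expr0 mulrBr -exprS mulr_sumr.
rewrite opprD addrA addrAC; congr (_ - _ - _).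
by apply: eq_bigr => k _; rewrite -exprS.
Qed.

(** The sign of [u ^+ 2 - u - 1] governs large [n]: [h] is positive at [tau R] and eventually
    negative at each point strictly between 1 and [tau R]. *)
Lemma horner_h_closed n u : (u - 1) * (h R n).[u] = u ^+ n * (u ^+ 2 - u - 1) + 1.
Proof.
elim: n => [|n IH]; first by rewrite horner_h0 expr0; ring.
have -> : (u - 1) * (h R n.+1).[u] = u * ((u - 1) * (h R n).[u]) - (u - 1).
  by rewrite horner_hS; ring.
by rewrite IH [u ^+ n.+1]exprS; ring.
Qed.

(** A nonnegative value of [h R n.+1] forces a positive one of [h R n], so the induction goes
    through. It follows that a positive root is unique. *)
Lemma horner_h_lt n u v : 0 < u -> u < v -> 0 <= (h R n).[u] ->
  (h R n).[u] < (h R n).[v].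
Proof.
move=> u0 uv; elim: n => [|n IH]; first by rewrite !horner_h0.
rewrite !horner_hS => hu.
have hu0 : 0 < (h R n).[u] by nra.
by have := IH (ltW hu0); nra.
Qed.

Lemma tau_gt1 : 1 < tau R.
Proof.
have : 1 < Num.sqrt 5 :> R by rewrite -[ltLHS]sqrtr1 ltr_sqrt; lra.
by rewrite /tau; lra.
Qed.

Lemma tau_sqr : tau R ^+ 2 = tau R + 1.
Proof.
have : Num.sqrt (5 : R) ^+ 2 = 5 by rewrite sqr_sqrtr; lra.
by rewrite /tau expr2; nra.
Qed.

Lemma lt_tau u : 0 <= u -> (u < tau R) = (u ^+ 2 < u + 1).
Proof.
have := tau_sqr; have := tau_gt1; set s := tau R => s1 s2 u0.
by apply/idP/idP => ?; [nra|rewrite ltNge; apply/negP => ?; nra].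
Qed.

Lemma horner_h_tau n : 0 < (h R n).[tau R].
Proof.
have := horner_h_closed n (tau R); have := tau_sqr; have := tau_gt1.
set s := tau R => s1 -> ; have -> : s + 1 - s - 1 = 0 by ring.
by rewrite mulr0 add0r => ?; nra.
Qed.

(** The intermediate value theorem on the interval from 1 to [tau R] gives a root, and [horner_h_lt]
    shows that it is the largest. *)
Lemma betaP n : (1 <= n)%N ->
  [/\ 1 <= beta R n, beta R n < tau R & (h R n).[beta R n] = 0].
Proof.
move=> n1; have h1 : (h R n).[1] <= 0.
  rewrite horner_hE expr1n (eq_bigr (fun => 1)) => [|k _]; last by rewrite expr1n.
  by rewrite sumr_const card_ord subr_le0 ler1n.
have [|b /andP[b1 bt] rb] := @poly_ivt _ (h R n) 1 (tau R) (ltW tau_gt1).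
  by rewrite h1 ltW // horner_h_tau.
have -> : beta R n = b.
  apply: maximumE => [|y [y0 /= /eqP hy]].
    by split => //; lra.
  rewrite leNgt; apply/negP => yb; move/eqP: rb => rb.
  have := @horner_h_lt n b y; rewrite rb hy ltxx lexx.
  by move=> /(_ ltac:(lra) yb isT).
split=> //; last exact/eqP.
rewrite lt_neqAle bt andbT; apply/eqP => E.
by move: rb; rewrite /root E gt_eqF // horner_h_tau.
Qed.

Lemma lt_beta n u : (1 <= n)%N -> 0 < u -> (u < beta R n) = ((h R n).[u] < 0).
Proof.
move=> n1 u0; have [b1 bt hb] := betaP n1.
apply/idP/idP => [ub|hu]; rewrite ltNge; apply/negP => H.
  by have := horner_h_lt u0 ub H; rewrite hb ltNge H.
move: H; rewrite le_eqVlt => /predU1P[E|bu].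
  by move: hu; rewrite -E hb ltxx.
have := @horner_h_lt n (beta R n) u; rewrite hb lexx => /(_ ltac:(lra) bu isT).
by move=> /(lt_trans hu); rewrite ltxx.
Qed.

Lemma beta_lt n : (1 <= n)%N -> beta R n < beta R n.+1.
Proof.
move=> n1; have [b1 bt hb] := betaP n1.
by rewrite lt_beta // ?horner_hS ?hb; lra.
Qed.

Lemma beta1 : beta R 1 = 1.
Proof.
have [b1 _ hb] := @betaP 1 isT; apply/eqP; rewrite eq_le b1 andbT leNgt.
rewrite lt_beta //; rewrite horner_hE big_ord1 expr1n expr0; lra.
Qed.

Lemma beta_ltn n m : (1 <= n)%N -> (n < m)%N -> beta R n < beta R m.
Proof.
move=> n1; elim: m => // m IH; rewrite ltnS leq_eqVlt => /predU1P[<-|nm].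
  exact: beta_lt.
by apply: lt_trans (IH nm) (beta_lt _); apply: ltn_trans nm.
Qed.

Lemma Bernoulli u n : 1 <= u -> 1 + n%:R * (u - 1) <= u ^+ n.
Proof.
move=> u1; elim: n => [|n IH]; first by rewrite expr0 mul0r addr0.
rewrite exprS -natr1; have n0 : 0 <= n%:R :> R := ler0n _ _.
have h := mulr_ge0 n0 (sqr_ge0 (u - 1)).
have u0 : 0 <= u by lra.
by apply: le_trans (ler_wpM2l u0 IH); rewrite expr2 in h; lra.
Qed.

Lemma beta_eventually_gt u : u < tau R ->
  exists2 n, (1 <= n)%N & forall m, (n <= m)%N -> u < beta R m.
Proof.
move=> ut; have [u1|u1] := leP u 1.
  (* Since [beta R 1] equals 1, the case [u = 1] requires [m >= 2]. *)
  exists 2%N => // m m2; have [b1 _ _] := @betaP 1 isT.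
  by have := @beta_ltn 1 m isT m2; lra.
have c0 : 0 < u + 1 - u ^+ 2 by rewrite subr_gt0 -lt_tau //; lra.
(* By Bernoulli's inequality this [n] makes [u ^+ n * (u + 1 - u ^+ 2)] exceed 1, hence [h R n]
   negative at [u]. *)
pose n := (Num.truncn (((u - 1) * (u + 1 - u ^+ 2))^-1)).+1.
have nP : ((u - 1) * (u + 1 - u ^+ 2))^-1 < n%:R by exact: truncnS_gt.
exists n => // m nm; have u0 : 0 < u by lra.
apply: (@lt_le_trans _ _ (beta R n)); last first.
  by move: nm; rewrite leq_eqVlt => /predU1P[->//|/beta_ltn/ltW]; apply.
rewrite lt_beta //.
have := horner_h_closed n u; have := Bernoulli n (ltW u1).
set c := u + 1 - u ^+ 2 in c0 nP *.
have -> : u ^+ 2 - u - 1 = - c by rewrite /c; ring.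
have : 1 < n%:R * (u - 1) * c.
  by rewrite -mulrA -ltr_pdivrMr ?div1r // mulr_gt0 // subr_gt0.
move=> h1 h2 h3; rewrite -(pmulr_rlt0 _ (_ : 0 < u - 1)) ?subr_gt0 // h3.
by nra.
Qed.

Lemma beta_cvg : beta R n @[n --> \oo] --> tau R.
Proof.
apply/cvgrPdist_lt => e e0.
have [|N N1 HN] := @beta_eventually_gt (tau R - e); first by lra.
exists N => // n /= Nn; have [|_ bt _] := @betaP n; first exact: leq_trans Nn.
by have := HN n Nn; rewrite gtr0_norm; lra.
Qed.

Lemma sqrt_ge1 u : 1 <= u -> 1 <= Num.sqrt u.
Proof. by move=> u1; rewrite -[leLHS]sqrtr1 ler_sqrt //; lra. Qed.

Lemma addV_lt s t : 1 <= s -> s < t -> s + s^-1 < t + t^-1.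
Proof.
move=> s1 st; rewrite -subr_gt0.
have -> : t + t^-1 - (s + s^-1) = (t - s) * (s * t - 1) / (s * t).
  by field; apply/andP; split; rewrite gt_eqF //; lra.
by rewrite divr_gt0 ?mulr_gt0 //; nra.
Qed.

Lemma addV_le s t : 1 <= s -> s <= t -> s + s^-1 <= t + t^-1.
Proof.
by move=> s1; rewrite le_eqVlt => /predU1P[->//|/(addV_lt s1)/ltW].
Qed.

Lemma sqrt_plus_inv_lt u v : 1 <= u -> u < v -> sqrt_plus_inv u < sqrt_plus_inv v.
Proof.
by move=> u1 uv; apply: addV_lt; rewrite ?sqrt_ge1 // ltr_sqrt //; lra.
Qed.

Lemma sqrt_plus_inv_lt2 u v : 1 <= u -> 1 <= v ->
  (sqrt_plus_inv u < sqrt_plus_inv v) = (u < v).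
Proof.
move=> u1 v1; apply/idP/idP; last exact: sqrt_plus_inv_lt.
rewrite !ltNge; apply: contra; rewrite le_eqVlt => /predU1P[->//|vu].
by rewrite ltW // sqrt_plus_inv_lt.
Qed.

(** The square is tau + 2 + 1/tau = 2 tau + 1, because 1/tau = tau - 1. *)
Lemma sqrt_plus_inv_tau : sqrt_plus_inv (tau R) = Num.sqrt (2 + Num.sqrt 5).
Proof.
have t1 := tau_gt1; have tV : (tau R)^-1 = tau R - 1.
  apply: (@mulfI _ (tau R)); first by rewrite gt_eqF //; lra.
  by rewrite divff; [have := tau_sqr; lra|rewrite gt_eqF //; lra].
have s1 := sqrt_ge1 (ltW t1).
have E : sqrt_plus_inv (tau R) ^+ 2 = 2 + Num.sqrt 5.
  rewrite /sqrt_plus_inv sqrrD exprVn sqr_sqrtr; last by lra.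
  rewrite divff; last by rewrite gt_eqF //; lra.
  by rewrite tV /tau; lra.
rewrite -E sqrtr_sqr ger0_norm // addr_ge0 ?invr_ge0 //; lra.
Qed.

Lemma alpha_cvg : alpha R n @[n --> \oo] --> sqrt_plus_inv (tau R).
Proof.
have cs : Num.sqrt (beta R n) @[n --> \oo] --> Num.sqrt (tau R).
  by apply: continuous_cvg beta_cvg; exact: sqrt_continuous.
apply: cvgD => //; apply: cvgV => //.
by rewrite gt_eqF // sqrtr_gt0; have := tau_gt1; lra.
Qed.

Lemma alpha_lt n : (1 <= n)%N -> alpha R n < alpha R n.+1.
Proof.
move=> n1; have [b1 _ _] := betaP n1.
by apply: sqrt_plus_inv_lt => //; exact: beta_lt.
Qed.

Lemma alpha1 : alpha R 1 = 2.
Proof. by rewrite /alpha beta1 /sqrt_plus_inv sqrtr1 invr1. Qed.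

Lemma sqrt_plus_inv_surj x : 2 <= x -> exists2 u, 1 <= u & x = sqrt_plus_inv u.
Proof.
move=> x2; pose s := Num.sqrt (x ^+ 2 - 4).
have s2 : s ^+ 2 = x ^+ 2 - 4 by rewrite sqr_sqrtr //; nra.
have s0 : 0 <= s by exact: sqrtr_ge0.
have t1 : 1 <= (x + s) / 2 by lra.
(* The square of the larger root of t^2 - x t + 1. *)
exists (((x + s) / 2) ^+ 2); first by nra.
rewrite /sqrt_plus_inv sqrtr_sqr ger0_norm; last by lra.
apply: (@mulIf _ ((x + s) / 2)); first by rewrite gt_eqF //; lra.
rewrite [RHS]mulrDl mulVf; last by rewrite gt_eqF //; lra.
by nra.
Qed.

End Beta.

(** * Limit points realised by caterpillars *)

Section PathWeight.
Variable R : realType.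
Implicit Types (x t u : R) (n k : nat).

(* The ratio of the path on k vertices rooted at an end. *)
Fixpoint path_ratio x k : R :=
  if k is j.+1 then (x - path_ratio x j)^-1 else 0.

(** Kept as a sum rather than a quotient by [u - 1], since [u = 1] occurs for [alpha R 1]. *)
Definition geom u k : R := \sum_(j < k) u ^+ j.

Lemma geomS u k : geom u k.+1 = geom u k + u ^+ k.
Proof. by rewrite /geom big_ord_recr. Qed.

Lemma geom_ge0 u k : 0 < u -> 0 <= geom u k.
Proof. by move=> u0; apply: sumr_ge0 => j _; rewrite ltW // exprn_gt0. Qed.

Lemma geom_gt0 u k : 0 < u -> 0 < geom u k.+1.
Proof. by move=> u0; rewrite geomS ltr_wpDl ?geom_ge0 // exprn_gt0. Qed.

(** At [t + t^-1] the path on [k] vertices has matching polynomial [geom (t ^+ 2) k.+1 / t ^+ k]. *)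
Lemma path_ratioE t k : 0 < t ->
  path_ratio (t + t^-1) k = t * geom (t ^+ 2) k / geom (t ^+ 2) k.+1.
Proof.
move=> t0; have u0 : 0 < t ^+ 2 by rewrite exprn_gt0.
elim: k => [|k IH] /=; first by rewrite /geom big_ord0 mulr0 mul0r.
rewrite IH; have g1 := geom_gt0 k u0; have g2 := geom_gt0 k.+1 u0.
have E2 : geom (t ^+ 2) k.+2 = (1 + t ^+ 2) * geom (t ^+ 2) k.+1 - t ^+ 2 * geom (t ^+ 2) k.
  by rewrite !geomS [t ^+ 2 ^+ k.+1]exprS; ring.
rewrite E2 in g2 *.
set a := geom _ k.+1 in g1 g2 *; set b := geom _ k in g2 *.
by field; rewrite !gt_eqF //= mulrDr mulr1 -expr2 ; nra.
Qed.

(** This is where [h] comes from: a vertex carrying a leaf and a path on [n] vertices has weight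
    [t], hence ratio [t], exactly when [h R n] vanishes at [t ^+ 2]. *)
Lemma path_gap t n : 0 < t ->
  t - (t + t^-1)^-1 - path_ratio (t + t^-1) n =
  t * (h R n).[t ^+ 2] / ((1 + t ^+ 2) * geom (t ^+ 2) n.+1).
Proof.
move=> t0; have u0 : 0 < t ^+ 2 by rewrite exprn_gt0.
rewrite path_ratioE // horner_hE -/(geom _ n); have := geom_gt0 n u0.
rewrite [t ^+ 2 ^+ n.+1]exprS geomS.
set a := geom _ n; set b := _ ^+ n => ab.
by field; rewrite !gt_eqF //=; nra.
Qed.

Lemma path_gap_gt0 t n : 0 < t ->
  ((t + t^-1)^-1 + path_ratio (t + t^-1) n < t) = (0 < (h R n).[t ^+ 2]).
Proof.
move=> t0; have u0 : 0 < t ^+ 2 by rewrite exprn_gt0.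
rewrite -subr_gt0 opprD addrA path_gap // -mulrA (mulrC (_.[_])) mulrA.
rewrite pmulr_rgt0 // divr_gt0 // mulr_gt0 ?geom_gt0 //; lra.
Qed.

Lemma path_gap_lt0 t n : 0 < t ->
  (t < (t + t^-1)^-1 + path_ratio (t + t^-1) n) = ((h R n).[t ^+ 2] < 0).
Proof.
move=> t0; have u0 : 0 < t ^+ 2 by rewrite exprn_gt0.
rewrite -subr_lt0 opprD addrA path_gap // -mulrA (mulrC (_.[_])) mulrA.
rewrite pmulr_rlt0 // divr_gt0 // mulr_gt0 ?geom_gt0 //; lra.
Qed.

(** The only leaf sits at spine vertex [n], behind a path on [n] vertices. The equation for
    [beta R n] makes the ratio there [t^-1], a fixed point of r |-> x - 1/r, so all later ratios are
    [t^-1 <= 1] and the products stay bounded. *)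
Lemma alpha_limit_point n : (1 <= n)%N -> is_limit_point (alpha R n).
Proof.
move=> n1; have [b1 _ hb] := betaP R n1.
set t := Num.sqrt (beta R n); have t1 : 1 <= t := sqrt_ge1 b1.
have t2 : t ^+ 2 = beta R n by rewrite sqr_sqrtr; lra.
have t0 : 0 < t by lra.
have u0 : 0 < t ^+ 2 by rewrite exprn_gt0.
rewrite /alpha /sqrt_plus_inv -/t; set x := t + t^-1.
have x1 : 1 <= x by rewrite /x; have := invr_gt0 t; rewrite t0; lra.
have x0 : 0 < x by lra.
pose a k : nat := (k == n).
have rlow k : (k < n)%N -> cat_ratio a x k = x - path_ratio x k.
  elim: k => [|k IH] kn /=; rewrite /a ltn_eqF ?mul0r ?subr0 //.
  by rewrite IH // ltnW.
have pos k : 0 < x - path_ratio x k.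
  have : 0 < path_ratio x k.+1 by rewrite /x path_ratioE // divr_gt0 ?mulr_gt0 ?geom_gt0.
  by rewrite /= invr_gt0.
have rn : cat_ratio a x n = t^-1.
  have := path_gap n t0; rewrite -/x t2 hb mulr0 mul0r => gap.
  have : cat_ratio a x n = x - x^-1 - path_ratio x n.
    have nE : n = n.-1.+1 by rewrite prednK.
    have -> : path_ratio x n = (x - path_ratio x n.-1)^-1 by rewrite {1}nE.
    have -> : cat_ratio a x n = x - (a n)%:R / x - (cat_ratio a x n.-1)^-1.
      by rewrite {1}nE /= -nE.
    by rewrite (rlow n.-1) ?prednK // /a eqxx mul1r.
  by move=> ->; rewrite /x in gap *; lra.
have rhigh j : cat_ratio a x (n + j) = t^-1.
  elim: j => [|j IH]; first by rewrite addn0.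
  rewrite addnS /= IH invrK /a gtn_eqF ?ltnS ?leq_addr // mul0r subr0 /x; ring.
apply: (@caterpillar_limit_point R a x (x ^+ n)) => // k.
  have [kn|nk] := ltnP k n; first by rewrite rlow.
  by rewrite -(subnKC nk) rhigh invr_gt0.
(* The first [n] ratios are at most [x] and the later ones at most 1. *)
apply: le_trans (_ : x ^+ minn k n <= _); last first.
  by rewrite ler_weXn2l // geq_minr.
elim: k => [|k IH]; first by rewrite big_ord0 min0n.
rewrite big_ord_recr /=.
have [kn|nk] := ltnP k n.
  move: IH; rewrite (minn_idPl (ltnW kn)) (minn_idPl kn) exprSr => IH.
  rewrite ler_pM //; first by apply: prodr_ge0 => j _; rewrite rlow ?ltW // (ltn_trans _ kn).
    by rewrite rlow // ltW.
  rewrite rlow // gerBl; case: (k) => [|m] //=.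
  by rewrite invr_ge0 ltW.
move: IH; rewrite (minn_idPr nk) (minn_idPr (leqW nk)) => IH.
rewrite -[leRHS]mulr1 -(subnKC nk) rhigh ler_pM //.
- apply: prodr_ge0 => j _; have [kn|nj] := ltnP j n; first by rewrite rlow // ltW.
  by rewrite -(subnKC nj) rhigh invr_ge0 ltW.
- by rewrite invr_ge0 ltW.
- by rewrite subnKC.
- by rewrite invf_le1.
Qed.

Lemma tau_limit_point : is_limit_point (sqrt_plus_inv (tau R)).
Proof.
apply/limit_pointP => e e0.
have /cvgrPdist_lt/(_ (e / 2))[|N _ HN] := @alpha_cvg R; first by lra.
have [b1 bt _] := @betaP R N.+1 isT.
have aN : alpha R N.+1 < sqrt_plus_inv (tau R) by exact: sqrt_plus_inv_lt.
have := HN N.+1 (leqnSn N); rewrite /= gtr0_norm ?subr_gt0 // => aNe.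
(* A graph this close to [alpha R N.+1] has its largest root below the limit and within twice the
   gap of it, hence within [e]. *)
have /limit_pointP/(_ (sqrt_plus_inv (tau R) - alpha R N.+1)) := @alpha_limit_point N.+1 isT.
rewrite subr_gt0 => /(_ aN)[G _]; rewrite ltr_norml => /andP[G1 G2].
exists G; first by rewrite lt_eqF //; lra.
by rewrite ltr_norml; lra.
Qed.

(** * The greedy caterpillar above the threshold *)

Section Greedy.
Variables t x : R.
Hypothesis ttau : tau R < t ^+ 2.
Hypothesis t0 : 0 < t.
Hypothesis xE : x = t + t^-1.

(* The first component is the largest number of leaves at the k-th spine vertex
   keeping the ratio, the second component, at least t^-1.  An infinite path can
   be attached exactly to the caterpillars whose last ratio is at least t^-1. *)
Fixpoint greedy k : nat * R :=
  let z := if k is j.+1 then x - (greedy j).2^-1 else x in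
  let m := Num.truncn (x * (z - t^-1)) in (m, z - m%:R / x).

Let a k := (greedy k).1.
Let r k := (greedy k).2.
Let q := t^-1 + x^-1.
Let f k := \prod_(j < k) r j.
Let D k := f k ^+ 2 * ((r k - t^-1) * (t - r k)).

Let t1 : 1 < t.
Proof. by have := tau_gt1 R; have := ttau; have := t0; nra. Qed.

Let x0 : 0 < x. Proof. by rewrite xE addr_gt0 // invr_gt0. Qed.
Let tV0 : 0 < t^-1. Proof. by rewrite invr_gt0. Qed.

Let z k := if k is j.+1 then x - (r j)^-1 else x.

Lemma greedy_ratioE k : r k = z k - (a k)%:R / x.
Proof. by case: k. Qed.

(** Rounding down leaves an excess over [t^-1] of less than one leaf, [x^-1]. The next step can
    start because [r k >= t^-1] gives [x - (r k)^-1 >= x - t = t^-1]. *)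
Lemma greedy_bounds k : t^-1 <= r k < q.
Proof.
have step j : t^-1 <= z j -> t^-1 <= r j < q.
  move=> zt; rewrite greedy_ratioE.
  have -> : a j = Num.truncn (x * (z j - t^-1)) by rewrite /a; case: j zt.
  have /Num.Theory.truncn_itv/andP[] : 0 <= x * (z j - t^-1).
    by rewrite mulr_ge0 ?subr_ge0 // ltW.
  set m := Num.truncn _; rewrite -natr1 => m1 m2.
  have {}m1 : m%:R / x <= z j - t^-1 by rewrite ler_pdivrMr // mulrC.
  have {}m2 : z j - t^-1 < m%:R / x + x^-1.
    have -> : m%:R / x + x^-1 = (m%:R + 1) / x by rewrite mulrDl mul1r.
    by rewrite ltr_pdivlMr // mulrC.
  by rewrite /q; apply/andP; split; lra.
elim: k => [|k /andP[IH _]]; apply: step; first by rewrite /z /= xE lerDr ltW.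
have : (r k)^-1 <= t by rewrite -[leRHS]invrK lef_pV2 ?posrE // (lt_le_trans tV0).
by rewrite /z /= xE; lra.
Qed.

Let r_gt0 k : 0 < r k.
Proof. by have /andP[rk _] := greedy_bounds k; exact: lt_le_trans rk. Qed.

(* This is where t ^+ 2 >= tau is needed. *)
Lemma q_bound : q * (x - x^-1) <= 2 /\ q < t.
Proof.
have E : x = (t ^+ 2 + 1) / t by rewrite xE; field; rewrite gt_eqF.
have u0 : 0 < t ^+ 2 + 1 by have := sqr_ge0 t; lra.
(* Both inequalities reduce to the sign of this quantity. *)
have d0 : 0 < (t ^+ 2) ^+ 2 - t ^+ 2 - 1.
  have := tau_sqr R; have := tau_gt1 R; have := ttau.
  by set s := tau R; set v := t ^+ 2; rewrite !expr2 => ? ? ?; nra.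
split; last first.
  rewrite -subr_gt0 /q.
  have -> : t - (t^-1 + x^-1) = ((t ^+ 2) ^+ 2 - t ^+ 2 - 1) / (t * (t ^+ 2 + 1)).
    by rewrite E; field; rewrite !gt_eqF.
  by rewrite divr_gt0 ?mulr_gt0.
rewrite -subr_ge0 /q.
have -> : 2 - (t^-1 + x^-1) * (x - x^-1) =
    ((t ^+ 2) ^+ 2 - t ^+ 2 - 1) / (t ^+ 2 * (t ^+ 2 + 1) ^+ 2).
  by rewrite E; field; rewrite !gt_eqF.
by rewrite divr_ge0 ?mulr_ge0 ?sqr_ge0 // ltW.
Qed.

(** A leaf costs at least [x^-1], so the product is at most [(x - x^-1) * r k - 1]; now [r k < q]
    and [q_bound] apply. *)
Lemma greedy_ratio_mul k : (0 < a k.+1)%N -> r k.+1 * r k <= 1.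
Proof.
move=> a1; have [qx _] := q_bound; have rk := r_gt0 k.
have /andP[_ rq] := greedy_bounds k.
have aV : x^-1 <= (a k.+1)%:R / x.
  by rewrite -[leLHS]mul1r ler_pM2r ?invr_gt0 // ler1n.
have : r k.+1 * r k <= (x - (r k)^-1 - x^-1) * r k.
  by rewrite ler_pM2r // greedy_ratioE /z; lra.
rewrite !mulrBl mulVf ?gt_eqF //.
have : (x - x^-1) * r k <= (x - x^-1) * q.
  apply: ler_wpM2l; last exact: ltW.
  have x1 : 1 <= x by rewrite xE; have := tV0; have := t1; lra.
  by rewrite subr_ge0 (le_trans _ x1) // invf_le1.
by rewrite mulrBl (mulrC _ q); lra.
Qed.

(* [- D k] is the quantity f_k^2 + f_(k+1)^2 - x f_k f_(k+1), which is conserved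
   along steps without leaves; [greedy_ratio_mul] gives its monotonicity along
   the other ones. *)
Lemma greedy_energy k : D k.+1 <= D k.
Proof.
have rk := r_gt0 k; rewrite /D /f big_ord_recr -/(f k) /= exprMn -mulrA.
apply: ler_wpM2l; first exact: sqr_ge0.
pose A := (a k.+1)%:R / x.
have A0 : 0 <= A by rewrite divr_ge0 // ltW.
have rE : r k.+1 = x - (r k)^-1 - A by rewrite greedy_ratioE.
have qE (s : R) : (s - t^-1) * (t - s) = x * s - 1 - s ^+ 2.
  by rewrite xE; field; rewrite gt_eqF.
(* The drop [D k - D k.+1] is [- f k.+1 ^+ 2] times this quantity. *)
have : A * (r k.+1 - (r k)^-1) <= 0.
  have [a0|a1] := posnP (a k.+1); first by rewrite /A a0 mul0r mul0r.
  apply: mulr_ge0_le0 => //; rewrite subr_le0 -[leRHS]mul1r ler_pdivlMr //.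
  exact: greedy_ratio_mul.
rewrite !qE => h.
have -> : x * r k - 1 - r k ^+ 2 = r k ^+ 2 * (x * (x - (r k)^-1) - 1 - (x - (r k)^-1) ^+ 2).
  by field; rewrite gt_eqF.
apply: ler_wpM2l; first exact: sqr_ge0.
rewrite -subr_ge0; have -> : x * (x - (r k)^-1) - 1 - (x - (r k)^-1) ^+ 2 -
    (x * r k.+1 - 1 - r k.+1 ^+ 2) = - (A * (r k.+1 - (r k)^-1)).
  by rewrite rE; ring.
by rewrite oppr_ge0.
Qed.

(** The products [f] grow only at ratios above 1. There the energy is at least [c * f k ^+ 2], and
    it never exceeds [D 0], so [f k ^+ 2 <= D 0 / c]; one further ratio, below [q], gives the bound
    [K]. *)
Lemma greedy_limit_point : is_limit_point x.
Proof.
have [_ qt] := q_bound.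
have q0 : 0 < q by rewrite addr_gt0 // invr_gt0.
have f0 k : 0 < f k by apply: prodr_gt0 => j _; exact: r_gt0.
have fS k : f k.+1 = r k * f k by rewrite /f big_ord_recr mulrC.
have DD k : D k <= D 0%N.
  by elim: k => // k IH; exact: le_trans (greedy_energy k) IH.
have tV1 : t^-1 < 1 by rewrite invf_lt1.
pose c := (1 - t^-1) * (t - q).
have c0 : 0 < c by rewrite mulr_gt0 // subr_gt0.
have D0 : 0 <= D 0%N.
  have /andP[rl rq] := greedy_bounds 0.
  by rewrite mulr_ge0 ?sqr_ge0 // mulr_ge0 // subr_ge0 // ltW // (lt_trans rq).
pose K := 1 + q ^+ 2 * (D 0%N / c).
have K1 : 1 <= K.
  by rewrite /K lerDl mulr_ge0 ?sqr_ge0 // divr_ge0 // ltW.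
have fK k : f k ^+ 2 <= K.
  elim: k => [|k IH]; first by rewrite /f big_ord0 expr1n.
  rewrite fS; have /andP[rl rq] := greedy_bounds k.
  have [r1|r1] := leP (r k) 1.
    rewrite exprMn; apply: le_trans IH; rewrite -[leRHS]mul1r.
    by rewrite ler_wpM2r ?sqr_ge0 // expr_le1 // ltW.
  have fc : f k ^+ 2 <= D 0%N / c.
    rewrite ler_pdivlMr //; apply: le_trans (DD k); rewrite /D.
    apply: ler_wpM2l; first exact: sqr_ge0.
    apply: ler_pM; rewrite ?subr_ge0 ?(ltW tV1) ?(ltW qt) //.
      by rewrite lerD2r ltW.
    by rewrite lerD2l lerN2 ltW.
  rewrite exprMn; apply: le_trans (_ : q ^+ 2 * (D 0%N / c) <= _); last first.
    by rewrite /K lerDr.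
  apply: ler_pM; rewrite ?sqr_ge0 //.
  by rewrite lerXn2r ?nnegrE ?(ltW (r_gt0 _)) ?(ltW q0) // ltW.
have rE k : cat_ratio a x k = r k.
  elim: k => [|k IH]; first by rewrite /= subr0.
  by rewrite greedy_ratioE /= IH addrAC.
apply: (@caterpillar_limit_point R a x K) => // [k|k]; first by rewrite rE.
rewrite (eq_bigr (fun j : 'I_k => r j)) => [|j _]; last exact: rE.
rewrite -/(f k); have [f1|f1] := leP (f k) 1; first exact: le_trans K1.
by apply: le_trans (fK k); rewrite expr2 ler_peMl // ltW.
Qed.

End Greedy.

(** At the threshold itself [q = t] and the constant [c] of the greedy argument vanishes; there the
    convergence of [alpha R n] is used. *)
Lemma limit_point_ge x : sqrt_plus_inv (tau R) <= x -> is_limit_point x.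
Proof.
rewrite le_eqVlt => /predU1P[<-|xt]; first exact: tau_limit_point.
have t1 := tau_gt1 R.
have x2 : 2 <= x.
  rewrite -alpha1; apply: ltW; apply: lt_trans xt.
  by have [b1 bt _] := @betaP R 1 isT; apply: sqrt_plus_inv_lt.
have [u u1 xE] := sqrt_plus_inv_surj x2.
have ut : tau R < u by rewrite -sqrt_plus_inv_lt2 // -?xE // ltW.
apply: (@greedy_limit_point (Num.sqrt u)) => //.
  by rewrite sqr_sqrtr //; lra.
by rewrite sqrtr_gt0; lra.
Qed.

End PathWeight.

(** * Limit points below the threshold *)

Section Below.
Variable R : realType.
Implicit Types (x t : R) (n k L N : nat) (T : tree) (cs : seq tree).

Lemma path_ratio_bounds x k : 2 <= x -> 0 <= path_ratio x k <= 1.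
Proof.
move=> x2; elim: k => [|k /andP[p0 p1]] /=; first by rewrite lexx ler01.
rewrite invr_ge0; apply/andP; split; first by lra.
by rewrite invf_le1; lra.
Qed.

Lemma path_ratio_leS x k : 2 <= x -> path_ratio x k <= path_ratio x k.+1.
Proof.
move=> x2; elim: k => [|k IH] /=.
  by rewrite subr0 invr_ge0; lra.
have /andP[_ p1] := path_ratio_bounds k x2.
have /andP[_ p2] := path_ratio_bounds k.+1 x2.
by move: p2 IH => /= p2 IH; rewrite lef_pV2 ?posrE; lra.
Qed.

Lemma path_ratio_le x k m : 2 <= x -> (k <= m)%N -> path_ratio x k <= path_ratio x m.
Proof.
move=> x2; elim: m => [|m IH]; first by rewrite leqn0 => /eqP->.
rewrite leq_eqVlt => /predU1P[->//|km].
exact: le_trans (IH km) (path_ratio_leS m x2).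
Qed.

Lemma path_ratio_cvg x k : 2 <= x -> path_ratio z k @[z --> x] --> path_ratio x k.
Proof.
move=> x2; elim: k => [|k IH] /=; first exact: cvg_cst.
apply: cvgV; first by have /andP[_ p1] := path_ratio_bounds k x2; rewrite gt_eqF //; lra.
by apply: cvgB => //; exact: cvg_id.
Qed.

(** All path ratios are at most [2 / x], the least weight of two children; applying w |-> 1 / (x -
    w) once more gives the comparison. *)
Lemma branching_ratio_ge x cs k : 2 <= x -> all (good x) cs -> weight x cs < x ->
  (1 < size cs)%N -> path_ratio x k <= ratio x (Node cs).
Proof.
move=> x2 gcs wx sz; have x0 : 0 < x by lra.
have w2 : 2 / x <= weight x cs.
  by apply: le_trans (weight_ge_size gcs); rewrite ler_pM2r ?invr_gt0 // ler_nat.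
have q1 : 2 / x <= 1 by rewrite ler_pdivrMr; lra.
have xx : 4 / x <= x by rewrite ler_pdivrMr //; nra.
have step j : path_ratio x j <= 2 / x -> path_ratio x j.+1 <= (x - 2 / x)^-1.
  by move=> pj /=; rewrite lef_pV2 ?posrE; lra.
have p2 j : path_ratio x j <= 2 / x.
  elim: j => [|j /step IH]; first by rewrite divr_ge0 //; lra.
  apply: le_trans IH _; rewrite ler_pdivlMr // -ler_pdivlMl ?invr_gt0 ?invrK; lra.
case: k => [|k]; first by rewrite ratioE invr_ge0; lra.
by apply: le_trans (step k (p2 k)) _; rewrite ratioE lef_pV2 ?posrE; lra.
Qed.

(** A tree that never branches is a path rooted at an end. Otherwise the first branching vertex
    dominates all path ratios, and vertices with a single child preserve this. *)
Lemma ratio_dichotomy x T : 2 <= x -> good x T ->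
  (exists k, ratio x T = path_ratio x k.+1) \/ (forall k, path_ratio x k <= ratio x T).
Proof.
move=> x2; pose P T := good x T -> (exists k, ratio x T = path_ratio x k.+1) \/
  (forall k, path_ratio x k <= ratio x T).
move: T; suff [] : (forall T, P T) /\
  (forall cs, if cs is [:: c] then P c else True) by [].
apply: tree_seq_ind => [//|c [|? ?]//|[|c [|c' cs]]].
- by move=> _ _; left; exists 0%N; rewrite ratioE weight_nil.
- move=> Pc /= /andP[/andP[gc _] wx].
  rewrite ratioE weight_cons weight_nil addr0 in wx *.
  have [[k ->]|H] := Pc gc; [by left; exists k.+1|right=> -[|k] /=].
    by rewrite invr_ge0; lra.
  have /andP[_ p1] := path_ratio_bounds k x2.
  by rewrite lef_pV2 ?posrE; have := H k; lra.
- move=> _ /andP[gcs wx]; right=> k.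
  exact: branching_ratio_ge.
Qed.

(** By the bounds on [x], a ratio in the window [[t1, t2]] forces the weight of the children into
    it. One child is then excluded by induction, three or more weigh too much, and two are compared
    with paths. *)
Lemma no_ratio_in x t1 t2 n T : 2 <= x ->
  0 < t1 -> t1 + t1^-1 <= x -> 0 < t2 -> x <= t2 + t2^-1 -> t2 * (x - x^-1) < 2 ->
  x^-1 + path_ratio x n < t1 -> t2 < x^-1 + path_ratio x n.+1 ->
  good x T -> t1 <= ratio x T <= t2 -> False.
Proof.
move=> x2 t10 xt1 t20 xt2 br pn pn1.
have x0 : 0 < x by lra.
have xV : x * x^-1 = 1 by rewrite divff // gt_eqF.
have xV0 : 0 < x^-1 by rewrite invr_gt0.
have xVx : x^-1 < x by nra.
(* Beside a leaf, the other ratio is that of a path on at most [n] or at least [n.+1] vertices, or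
   dominates all path ratios; without a leaf the sum is at least [2 / (x - x^-1)]. *)
have two T1 T2 : good x T1 -> good x T2 -> ~~ (t1 <= ratio x T1 + ratio x T2 <= t2).
  have leafP T0 : good x T0 -> ratio x T0 = x^-1 \/ (x - x^-1)^-1 <= ratio x T0.
    case: T0 => -[|c cs]; first by left; rewrite ratioE weight_nil subr0.
    move=> /andP[/andP[gc gcs] wx]; right; rewrite ratioE lef_pV2 ?posrE ?subr_gt0 //.
    rewrite lerD2l lerN2 weight_cons; have := weight_ge0 gcs; have := ratio_ge gc; lra.
  have leaf T0 : good x T0 -> ~~ (t1 <= x^-1 + ratio x T0 <= t2).
    move=> /(ratio_dichotomy x2)[[k ->]|/(_ n.+1) H]; apply/negP => /andP[H1 H2].
      have [kn|nk] := leqP k.+1 n; first by have := path_ratio_le x2 kn; lra.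
      by have := path_ratio_le x2 nk; lra.
    by lra.
  move=> g1 g2; have [->|H1] := leafP _ g1; first exact: leaf.
  have [->|H2] := leafP _ g2; first by rewrite addrC leaf.
  apply/negP => /andP[_]; rewrite leNgt => /negP; apply.
  have : t2 < 2 * (x - x^-1)^-1 by rewrite ltr_pdivlMr ?subr_gt0.
  by lra.
suff [H _] : (forall T, good x T -> ~~ (t1 <= ratio x T <= t2)) /\
    (forall cs, all (good x) cs -> ~~ (t1 <= weight x cs <= t2)).
  by move=> /H/negP.
apply: tree_seq_ind => [_|c [|c' [|c'' cs]] Hc Hcs|cs Hcs].
- by rewrite weight_nil; apply/negP => /andP[]; lra.
- by rewrite /= andbT weight_cons weight_nil addr0.
- by move=> /and3P[gc gc' _]; rewrite !weight_cons weight_nil addr0 two.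
- move=> g3; have := weight_ge_size g3; set w := weight _ _ => w3.
  apply/negP => /andP[_ wt]; have : 3 / x <= w.
    by apply: le_trans w3; rewrite ler_pM2r // ler_nat.
  rewrite -/(3 * x^-1) => ?; nra.
move=> /andP[gcs wx]; apply/negP => /andP[r1 r2].
have /negP := Hcs gcs; apply.
have wE : weight x cs = x - (ratio x (Node cs))^-1 by rewrite ratioE invrK; ring.
have r0 := lt_le_trans t10 r1.
have i1 : (ratio x (Node cs))^-1 <= t1^-1 by rewrite lef_pV2.
have i2 : t2^-1 <= (ratio x (Node cs))^-1 by rewrite lef_pV2.
by rewrite wE; apply/andP; split; lra.
Qed.

End Below.

(** * Long paths in trees at their critical value *)

Section Spine.
Variable R : realType.
Implicit Types (x t : R) (n k L N : nat) (T U D : tree) (cs : seq tree) (a b c : nat -> R).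

(* A path of L.+1 edges in a tree at its critical value x: a k and b k are the
   ratios of the two components left by removing the k-th edge, and c k is the
   weight of the branches hanging between the edges k and k.+1. *)
Definition spine x L a b c : Prop :=
  [/\ forall k, (k <= L)%N -> [/\ 0 < a k, 0 < b k & a k * b k = 1],
      forall k, (k < L)%N -> a k + c k + b k.+1 = x &
      forall k, (k < L)%N -> c k = 0 \/ x^-1 <= c k].

Lemma spine_rev x L a b c : spine x L a b c ->
  spine x L (fun k => b (L - k)%N) (fun k => a (L - k)%N) (fun k => c (L - k.+1)%N).
Proof.
move=> [ab abc c0]; split=> k kL.
- by have [|a0 b0 e] := ab (L - k)%N; [exact: leq_subr|rewrite mulrC].
- have kE : (L - k = (L - k.+1).+1)%N by rewrite subnSK.
  rewrite kE -(abc (L - k.+1)%N); first by rewrite addrC addrA addrAC.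
  by rewrite -kE leq_subr.
- by apply: c0; rewrite ltn_subrL (leq_ltn_trans _ kL).
Qed.

Lemma has_split (A : Type) (p : pred A) (s : seq A) : has p s ->
  exists l1 d l2, s = l1 ++ d :: l2 /\ p d.
Proof.
elim: s => //= d s IHs /orP[pd|/IHs]; first by exists [::], d, s.
by move=> [l1 [d' [l2 [-> pd']]]]; exists (d :: l1), d', l2.
Qed.

(** The walk descends in [D]. On passing to a child [d], the vertex left behind becomes the root of
    the new upper tree, with [U] and the siblings of [d] as branches, and the product of the two
    ratios remains 1. *)
Lemma exists_spine x L U D : good x U -> good x D -> ratio x U * ratio x D = 1 ->
  deep L D -> exists (fU fD : nat -> tree) c,
  [/\ forall k, (k <= L)%N -> good x (fU k) /\ good x (fD k),
      fU 0%N = U, fD 0%N = D &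
      spine x L (fun k => ratio x (fU k)) (fun k => ratio x (fD k)) c].
Proof.
elim: L U D => [|L IH] U D gU gD UD deepD.
  exists (fun=> U), (fun=> D), (fun=> 0); split=> //.
  by split=> // k _; rewrite !ratio_gt0.
case: D gD UD deepD => cs gD UD deepD.
have [l1 [d [l2 [csE deepd]]]] := has_split deepD.
have := gD; rewrite /= csE all_cat /= weight_cat weight_cons.
move=> /andP[/and3P[gl1 gd gl2] wx].
have rest : all (good x) (l1 ++ l2) by rewrite all_cat gl1.
have wE : weight x (l1 ++ l2) = weight x l1 + weight x l2 by exact: weight_cat.
have rUE : ratio x U = x - ratio x d - weight x (l1 ++ l2).
  have := UD; rewrite ratioE csE weight_cat weight_cons => /divr1_eq ->.
  by rewrite wE; ring.
have d0 := ratio_gt0 gd; have U0 := ratio_gt0 gU.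
have gU' : good x (Node (U :: l1 ++ l2)).
  by rewrite /= gU rest weight_cons rUE /=; lra.
have [|fU [fD [c [gf fU0 fD0 [ab abc c0]]]]] := IH _ _ gU' gd _ deepd.
  rewrite ratioE weight_cons rUE mulrC -[RHS](divff (_ : ratio x d != 0)) ?gt_eqF //.
  by congr (_ / _); ring.
exists (fun k => if k is j.+1 then fU j else U).
exists (fun k => if k is j.+1 then fD j else Node cs).
exists (fun k => if k is j.+1 then c j else weight x (l1 ++ l2)).
split=> //; first by case=> // k kL; exact: gf.
  by rewrite csE.
split=> -[|k] kL.
- by split; rewrite ?ratio_gt0.
- exact: ab.
- by rewrite fD0 rUE; ring.
- exact: abc.
- case: (l1 ++ l2) rest {gU' wE rUE fU0} => [|d' cs'] rest; first by left; rewrite weight_nil.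
  right; apply: le_trans (weight_ge_size rest).
  by rewrite -[leLHS]mul1r ler_pM2r ?invr_gt0 ?ler1n // (good_gt0 gU).
- exact: c0.
Qed.

Lemma critical_spine x L T : critical x T -> deep L.+1 T ->
  exists (fU fD : nat -> tree) c,
  (forall k, (k <= L)%N -> good x (fU k) /\ good x (fD k)) /\
  spine x L (fun k => ratio x (fU k)) (fun k => ratio x (fD k)) c.
Proof.
case: T => cs /= /andP[gcs /eqP wx] deepT.
have [l1 [d [l2 [csE deepd]]]] := has_split deepT.
move: gcs wx; rewrite csE all_cat /= weight_cat weight_cons => /and3P[gl1 gd gl2] wx.
have d0 := ratio_gt0 gd.
have wE : weight x (l1 ++ l2) = x - ratio x d by rewrite weight_cat; lra.
have gU : good x (Node (l1 ++ l2)) by rewrite /= all_cat gl1 gl2 wE /=; lra.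
have [|fU [fD [c [gf _ _ sp]]]] := exists_spine gU gd _ deepd; last by exists fU, fD, c.
by rewrite ratioE wE subKr mulVf // gt_eqF.
Qed.

(** Since [b k + (b k)^-1 >= 2], each step lowers [b] by at least [e], and positivity limits the
    length. *)
Lemma spine_lt2 x e L a b c : 0 < e -> x + e <= 2 -> 0 < x -> spine x L.+1 a b c ->
  L%:R * e < 2.
Proof.
move=> e0 x2 x0 [ab abc c0].
have decr k : (k <= L)%N -> b k.+1 + e <= b k.
  move=> kL; have [a1 b1 abE] := ab k (leqW kL).
  have E := abc k kL.
  have ck : 0 <= c k by case: (c0 k kL) => [->//|]; apply: le_trans; rewrite invr_ge0 ltW.
  by have := sqr_ge0 (b k - 1); rewrite -lerBrDr; nra.
have low k : (k <= L)%N -> k%:R * e <= b (L.+1 - k)%N.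
  elim: k => [|k IH] kL.
    by rewrite mul0r ltW //; have [] := ab L.+1 (leqnn _).
  have kE : (L.+1 - k = (L.+1 - k.+1).+1)%N by rewrite subnSK // ltnW.
  have := decr (L.+1 - k.+1)%N; rewrite -kE subSS leq_subr => /(_ isT).
  by have := IH (ltnW kL); rewrite -natr1; lra.
have := low L (leqnn L); rewrite subSnn.
have := abc 0%N isT; have [a0 _ _] := ab 0%N isT.
have : 0 <= c 0%N.
  by case: (c0 0%N isT) => [->//|]; apply: le_trans; rewrite invr_ge0 ltW.
by lra.
Qed.

(** If [a k.+1 < t2^-1], then [a k.+1 + b k.+1] exceeds [x + e], so [a k] is smaller than [a k.+1]
    by more than [e]. Repeated backwards, this contradicts positivity before the start of the spine
    is reached. *)
Lemma spine_ratio_ge x t2 e L a b c k : 0 < e -> 0 < x -> x <= 3 -> 1 <= t2 ->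
  x + e <= t2 + t2^-1 -> spine x L a b c -> (k <= L)%N -> 3 <= k%:R * e ->
  t2^-1 <= a k.
Proof.
move=> e0 x0 x3 t21 xt2 [ab abc c0] kL ke.
have t2V : t2^-1 <= 1 by rewrite invf_le1; lra.
have [//|/= ak] : t2^-1 <= a k \/ k%:R * e <= a k; last by lra.
move: kL {ke}; elim: k => [|k IH] kL.
  by right; rewrite mul0r ltW //; have [] := ab 0%N isT.
have [a0 b0 abE] := ab k.+1 kL.
have [|ak] := leP t2^-1 (a k.+1); [by left|right].
have ck : 0 <= c k by case: (c0 k kL) => [->//|]; apply: le_trans; rewrite invr_ge0 ltW.
have abcE := abc k kL.
have bE : b k.+1 = (a k.+1)^-1.
  by apply: (@mulfI _ (a k.+1)); rewrite ?divff ?abE // gt_eqF.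
have : (t2^-1)^-1 + t2^-1 < (a k.+1)^-1 + a k.+1.
  have := @addV_lt R (t2^-1)^-1 (a k.+1)^-1; rewrite !invrK; apply; first by [].
  by rewrite -[ltLHS]invrK ltf_pV2 ?posrE // invr_gt0; lra.
rewrite invrK -bE -natr1 => psi.
have : a k + e < a k.+1 by lra.
have [|] := IH (ltnW kL); lra.
Qed.

(** A branch weighs at least [x^-1] and leaves at most [x - x^-1 < 2 / t2] for [a k + b k.+1], but
    far from the ends both summands are at least [t2^-1]. *)
Lemma spine_no_branch x t2 e L a b c N k : 0 < e -> 0 < x -> x <= 3 -> 1 <= t2 ->
  x + e <= t2 + t2^-1 -> t2 * (x - x^-1) < 2 -> 3 <= N%:R * e -> spine x L a b c ->
  (N <= k)%N -> (k.+1 + N <= L)%N -> c k = 0.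
Proof.
move=> e0 x0 x3 t21 xt2 br Ne sp Nk kL.
have kltL : (k < L)%N by apply: leq_trans kL; exact: leq_addr.
have mono m : (N <= m)%N -> 3 <= m%:R * e.
  by rewrite -(ler_nat R) => Nm; apply: le_trans Ne _; rewrite ler_pM2r.
have ak : t2^-1 <= a k.
  by apply: (spine_ratio_ge e0 x0 x3 t21 xt2 sp); [exact: ltnW|exact: mono].
have bk : t2^-1 <= b k.+1.
  have := @spine_ratio_ge x t2 e L _ _ _ (L - k.+1)%N e0 x0 x3 t21 xt2 (spine_rev sp).
  rewrite subKn //; apply; first exact: leq_subr.
  by apply: mono; clear -kL; lia.
have [_ abc c0] := sp; have := abc k kltL.
have [//|ck] := c0 k kltL.
have : x - x^-1 < 2 * t2^-1 by rewrite ltr_pdivlMr 1?mulrC //; lra.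
by lra.
Qed.

(* Away from its ends the spine does not branch, and the map b |-> x - b^-1
   is there attracted by [t1, t2]. *)
Lemma spine_attracted x t1 t2 e a b c N : 0 < e -> 2 <= x -> x <= 3 ->
  1 <= t1 -> t1 <= t2 -> t1 + t1^-1 + e <= x -> x + e <= t2 + t2^-1 ->
  t2 * (x - x^-1) < 2 -> 3 < N%:R * e -> spine x (4 * N) a b c ->
  1 <= b (2 * N)%N -> t1 <= b (3 * N)%N <= t2.
Proof.
move=> e0 x2 x3 t11 t12 xt1 xt2 br Ne sp b1.
have x0 : 0 < x by lra.
have N0 : (0 < N)%N by case: N Ne {sp b1} => //; rewrite mul0r; lra.
have [ab abc c0] := sp.
have step k : (N <= k)%N -> (k.+1 + N <= 4 * N)%N -> b k.+1 = x - (b k)^-1.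
  move=> Nk kL; have kltL : (k < 4 * N)%N by clear -kL; lia.
  have ck := spine_no_branch e0 x0 x3 (le_trans t11 t12) xt2 br (ltW Ne) sp Nk kL.
  have [a0 b0 abE] := ab k (ltnW kltL).
  have <- : a k = (b k)^-1 by apply: (@mulIf _ (b k)); rewrite ?mulVf ?abE // gt_eqF.
  by have := abc k kltL; rewrite ck; lra.
have b2x : b (2 * N)%N <= x.
  have mL : ((2 * N).-1 < 4 * N)%N by clear -N0; lia.
  have := abc _ mL; rewrite prednK ?muln_gt0 //.
  have [a0 _ _] := ab _ (ltnW mL).
  have : 0 <= c (2 * N).-1.
    by case: (c0 _ mL) => [->//|]; apply: le_trans; rewrite invr_ge0 ltW.
  lra.
have track j : (j <= N)%N -> let b' := b (2 * N + j)%N in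
    [\/ t1 <= b' <= t2, 1 + j%:R * e <= b' < t1 | t2 < b' <= x - j%:R * e].
  elim: j => [|j IH] jN /=.
    rewrite addn0 mul0r addr0 subr0.
    have [bt1|bt1] := ltP (b (2 * N)%N) t1; first by apply: Or32; rewrite b1.
    have [bt2|bt2] := leP (b (2 * N)%N) t2; first by apply: Or31.
    by apply: Or33.
  rewrite addnS step; [|clear -jN; lia|clear -jN; lia].
  have := IH (ltnW jN); set b' := b _ => /= bP.
  have b'1 : 1 <= b'.
    have je : 0 <= j%:R * e by rewrite mulr_ge0 // ltW.
    by case: bP => /andP[]; lra.
  have t1V s : t1 <= s -> s^-1 <= t1^-1 by move=> ts; rewrite lef_pV2 ?posrE; lra.
  have t2V s : 1 <= s -> s <= t2 -> t2^-1 <= s^-1.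
    by move=> s1 ts; rewrite lef_pV2 ?posrE; lra.
  case: bP => /andP[l u].
  - by apply: Or31; have := t1V _ l; have := t2V _ b'1 u; lra.
  - have up := addV_le b'1 (ltW u); have iv := t2V _ b'1 ltac:(lra).
    have [?|?] := ltP (x - b'^-1) t1; [apply: Or32|apply: Or31];
      rewrite -?natr1 ?andbT /=; lra.
  - have t21 : 1 <= t2 by lra.
    have up := addV_le t21 (ltW l); have iv := t1V b' ltac:(lra).
    have [?|?] := leP (x - b'^-1) t2; [apply: Or31|apply: Or33];
      rewrite -?natr1 ?andbT /=; lra.
have := track N (leqnn N); rewrite /= -mulSnr.
have tV : 0 <= t1^-1 by rewrite invr_ge0; lra.
by case=> // /andP[]; lra.
Qed.

(** The two ratios at the middle edge multiply to 1, so one of them is at least 1 and is attracted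
    into the window; if it is the upper one, the spine is reversed. *)
Lemma shallow_of_no_ratio_in x t1 t2 e N T : 0 < e -> 2 <= x -> x <= 3 ->
  1 <= t1 -> t1 <= t2 -> t1 + t1^-1 + e <= x -> x + e <= t2 + t2^-1 ->
  t2 * (x - x^-1) < 2 -> 3 < N%:R * e ->
  (forall T', good x T' -> ~~ (t1 <= ratio x T' <= t2)) ->
  critical x T -> ~~ deep (4 * N).+1 T.
Proof.
move=> e0 x2 x3 t11 t12 xt1 xt2 br Ne none cT; apply/negP => dT.
have [fU [fD [c [gf sp]]]] := critical_spine cT dT.
have [|b1] := ltP (ratio x (fD (2 * N)%N)) 1; last first.
  have := spine_attracted e0 x2 x3 t11 t12 xt1 xt2 br Ne sp b1.
  by apply/negP/none; have [|] := gf (3 * N)%N; first by rewrite leq_mul2r orbT.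
have mL : (2 * N <= 4 * N)%N by rewrite leq_mul2r orbT.
have [ab _ _] := sp; have [a0 b0 abE] := ab _ mL.
have mm : (4 * N - 2 * N = 2 * N)%N by rewrite -mulnBl.
move=> b1; have := spine_attracted e0 x2 x3 t11 t12 xt1 xt2 br Ne (spine_rev sp).
rewrite mm => H; have {}H := H ltac:(nra).
move: H => /=; apply/negP/none.
by have [|] := gf (4 * N - 3 * N)%N => //; exact: leq_subr.
Qed.

(** Bounded height and at most 9 children per vertex leave finitely many trees, hence finitely many
    critical values near [gamma]. *)
Lemma not_limit_point (gamma : R) n :
  (\forall x \near gamma, x <= 3 /\ forall T, critical x T -> ~~ deep n T) ->
  ~ is_limit_point gamma.
Proof.
move=> /nbhs_ballP[e /= e0 He] /limit_pointP lim.
(* Trees without a critical value get 0, which adds at most one point to a finite set. *)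
pose val T := xget 0 [set x : R | critical x T].
have valE x T : critical x T -> val T = x.
  by move=> cx; apply: xget_unique => //= y cy; exact: critical_uniq cy cx.
pose A := (val @` [set T | ~~ deep n T /\ narrow 9 T]) `\ gamma.
have finA : finite_set A.
  by apply: finite_setD; apply: finite_image; exact: finite_shallow.
have : open_nbhs gamma (~` A).
  split; last by move=> [_]; apply.
  apply: closed_openC; apply: (iffLR accessible_finite_set_closed) finA.
  exact/hausdorff_accessible/norm_hausdorff.
move=> /open_nbhs_nbhs/nbhs_ballP[d /= d0 Hd].
have [|G Gg] := lim (Num.min e d); first by rewrite lt_min e0.
rewrite lt_min distrC => /andP[Ge Gd].
have [T cT] := critical_tree R G.
have [x3 /(_ T cT) dT] := He _ Ge.
apply: (Hd _ Gd); split; last by move=> E; rewrite E eqxx in Gg.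
exists T; last exact: valE.
split=> //; case: T cT {dT} => cs /= /andP[gcs /eqP wx].
rewrite (good_size gcs) ?wx // (sub_all _ gcs) // => T'.
exact: good_narrow.
Qed.

End Spine.

(** * Excluding the gaps below the threshold *)

Section Main.
Variable R : realType.
Implicit Types (x t u gamma : R) (n : nat).

Lemma limit_point_ge2 gamma : is_limit_point gamma -> 2 <= gamma.
Proof.
move=> lim; rewrite leNgt; apply/negP => g2; move: lim.
pose e := (2 - gamma) / 2; have e0 : 0 < e by rewrite /e; lra.
pose L := (Num.truncn (2 / e)).+1.
have Le : 2 < L%:R * e by rewrite -ltr_pdivrMr // truncnS_gt.
apply: (@not_limit_point R gamma L.+2).
near=> x.
have xe : x < gamma + e by near: x; apply: lt_nbhsl; rewrite ltrDl.
split=> [|T cT]; first by rewrite /e in xe; lra.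
apply/negP => dT.
have [fU [fD [c [gf sp]]]] := critical_spine cT dT.
have x0 : 0 < x by have [gU _] := gf 0%N isT; exact: good_gt0 gU.
have := spine_lt2 e0 _ x0 sp; rewrite {1}/e => /(_ ltac:(rewrite /e in xe; lra)).
by move=> /(lt_trans Le); rewrite ltxx.
Unshelve. all: by end_near.
Qed.

Lemma not_limit_point_between n u : (1 <= n)%N -> beta R n < u -> u < beta R n.+1 ->
  ~ is_limit_point (sqrt_plus_inv u).
Proof.
move=> n1 bu ub.
have [b1 _ _] := betaP R n1; have [_ bt _] := @betaP R n.+1 isT.
have u1 : 1 < u by lra.
have u0 : 0 < u by lra.
have ut : u ^+ 2 < u + 1 by rewrite -lt_tau; lra.
set t := Num.sqrt u.
have tt : t ^+ 2 = u by rewrite sqr_sqrtr //; lra.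
have t1 : 1 < t by rewrite -sqrtr1 ltr_sqrt.
have t0 : 0 < t by lra.
rewrite /sqrt_plus_inv -/t; set gamma := t + t^-1.
have g2 : 2 < gamma.
  by have := addV_lt (lexx 1) t1; rewrite invr1 /gamma; lra.
have g0 : 0 < gamma by lra.
have gE : gamma = (u + 1) / t by rewrite /gamma -tt; field; rewrite gt_eqF.
(* Equivalent to [u ^+ 2 < u + 1], that is, to [u < tau R]. *)
have br : t * (gamma - gamma^-1) < 2.
  have -> : t * (gamma - gamma^-1) = u + 1 - u / (u + 1).
    by rewrite gE -tt; field; rewrite !gt_eqF //; have := sqr_ge0 t; lra.
  have : u / (u + 1) * (u + 1) = u by rewrite divfK // gt_eqF; lra.
  by set w := u / (u + 1); nra.
have pn : gamma^-1 + path_ratio gamma n < t.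
  rewrite path_gap_gt0 // tt.
  by have [_ _ hb] := betaP R n1; rewrite -{1}hb horner_h_lt ?hb //; lra.
have pn1 : t < gamma^-1 + path_ratio gamma n.+1.
  by rewrite path_gap_lt0 // tt -lt_beta.
have gV : 0 < gamma - gamma^-1.
  by rewrite subr_gt0 (@lt_trans _ _ 1) ?invf_lt1 //; lra.
(* The window from [s1] to [s2] around [t] is taken inside the strict inequalities [pn], [pn1] and
   [br], so that they persist for [x] near [gamma]. *)
have [s1 [s11 s1t ps1]] : exists s1, [/\ 1 <= s1, s1 < t & gamma^-1 + path_ratio gamma n < s1].
  have m : Num.max 1 (gamma^-1 + path_ratio gamma n) < t by rewrite gt_max t1.
  move: (midf_lt m) => [l r]; exists ((Num.max 1 (gamma^-1 + path_ratio gamma n) + t) / 2).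
  by move: l; rewrite gt_max => /andP[l l']; split; rewrite // ltW.
have [s2 [ts2 s2p br2]] : exists s2, [/\ t < s2, s2 < gamma^-1 + path_ratio gamma n.+1 &
    s2 * (gamma - gamma^-1) < 2].
  have m : t < Num.min (gamma^-1 + path_ratio gamma n.+1) (2 / (gamma - gamma^-1)).
    by rewrite lt_min pn1 ltr_pdivlMr.
  move: (midf_lt m) => [l r].
  exists ((t + Num.min (gamma^-1 + path_ratio gamma n.+1) (2 / (gamma - gamma^-1))) / 2).
  by move: r; rewrite lt_min ltr_pdivlMr // => /andP[r r']; split.
have psi1 : s1 + s1^-1 < gamma by exact: addV_lt.
have psi2 : gamma < s2 + s2^-1 by apply: addV_lt => //; exact: ltW.
(* Half of the slack; the other half absorbs the distance from [x] to [gamma]. *)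
pose e := Num.min (gamma - (s1 + s1^-1)) (s2 + s2^-1 - gamma) / 2.
have e0 : 0 < e by rewrite divr_gt0 // lt_min !subr_gt0 psi1.
have [e1 e2] : e <= (gamma - (s1 + s1^-1)) / 2 /\ e <= (s2 + s2^-1 - gamma) / 2.
  by rewrite /e; split; rewrite ler_pM2r ?invr_gt0 // ge_min lexx ?orbT.
pose N := (Num.truncn (3 / e)).+1.
have Ne : 3 < N%:R * e by rewrite -ltr_pdivrMr // truncnS_gt.
have g3 : gamma < 3.
  have : t < 2 by nra.
  have : t^-1 < 1 by rewrite invf_lt1.
  by rewrite /gamma; lra.
have cV : z^-1 @[z --> gamma] --> gamma^-1.
  by apply: cvgV; [rewrite gt_eqF|exact: cvg_id].
apply: (@not_limit_point R gamma (4 * N).+1); near=> x.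
have x2 : 2 <= x by apply: ltW; near: x; exact: lt_nbhsr.
have x3 : x <= 3 by apply: ltW; near: x; exact: lt_nbhsl.
split=> // T cT.
have x1e : s1 + s1^-1 + e <= x by apply: ltW; near: x; apply: lt_nbhsr; lra.
have x2e : x + e <= s2 + s2^-1.
  by rewrite -lerBrDr; apply: ltW; near: x; apply: lt_nbhsl; lra.
have xbr : s2 * (x - x^-1) < 2.
  near: x; apply: cvgr_lt br2; apply: cvgM; first exact: cvg_cst.
  by apply: cvgB => //; exact: cvg_id.
have s12 : s1 <= s2 by rewrite ltW // (lt_trans s1t).
apply: (shallow_of_no_ratio_in e0 x2 x3 s11 s12 x1e x2e xbr Ne) cT => T' gT'.
have s10 : 0 < s1 := lt_le_trans ltr01 s11.
have x1 : s1 + s1^-1 <= x by apply: le_trans x1e; rewrite lerDl ltW.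
have x2' : x <= s2 + s2^-1 by apply: le_trans x2e; rewrite lerDl ltW.
apply/negP; apply: no_ratio_in x2 s10 x1 (lt_le_trans s10 s12) x2' xbr _ _ gT'.
  near: x; apply: cvgr_lt ps1; apply: cvgD => //.
  by apply: path_ratio_cvg; exact: ltW.
near: x; apply: cvgr_gt s2p; apply: cvgD => //.
by apply: path_ratio_cvg; exact: ltW.
Unshelve. all: by end_near.
Qed.

Lemma limit_point_below gamma : is_limit_point gamma ->
  gamma < sqrt_plus_inv (tau R) -> exists2 n, (1 <= n)%N & alpha R n = gamma.
Proof.
move=> lim gt; have g2 := limit_point_ge2 lim.
have [u u1 gE] := sqrt_plus_inv_surj g2.
have tau1 := tau_gt1 R.
have ut : u < tau R by rewrite -sqrt_plus_inv_lt2 -?gE //; lra.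
have [N _ HN] := beta_eventually_gt ut.
have ex : exists n, u < beta R n.+1 by exists N; apply: HN.
(* For this least [n], [beta R n <= u < beta R n.+1]; the value [n = 0] is impossible because
   [beta R 1 = 1 <= u]. *)
pose n := ex_minn ex.
have [un n_min] : u < beta R n.+1 /\ forall m, u < beta R m.+1 -> (n <= m)%N.
  by rewrite /n; case: ex_minnP.
case: n un n_min => [|n] un n_min; first by move: un; rewrite beta1; lra.
have bn : beta R n.+1 <= u.
  by rewrite leNgt; apply/negP => /n_min; rewrite ltnn.
exists n.+1 => //; rewrite gE /alpha; congr sqrt_plus_inv.
apply/eqP; rewrite eq_le bn /= leNgt; apply/negP => bu.
by apply: (@not_limit_point_between n.+1 u) => //; rewrite -gE.
Qed.

End Main.

Theorem theorem1p1 (R : realType) :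
  [/\ [set gamma : R | is_limit_point gamma] =
        [set alpha R n | n in [set n : nat | (1 <= n)%N]] `|`
        [set x : R | sqrt_plus_inv (tau R) <= x],
      alpha R 1 = 2,
      forall n : nat, (1 <= n)%N -> alpha R n < alpha R n.+1,
      alpha R n @[n --> \oo] --> sqrt_plus_inv (tau R) &
      sqrt_plus_inv (tau R) = Num.sqrt (2 + Num.sqrt 5)].
Proof.
split; last 1 first.
- exact: sqrt_plus_inv_tau.
- apply/seteqP; split=> [gamma /= lim|gamma [[n /= n1 <-]|/= gt]].
  + have [|gt] := leP (sqrt_plus_inv (tau R)) gamma; first by right.
    by left; have [n n1 <-] := limit_point_below lim gt; exists n.
  + exact: alpha_limit_point.
  + exact: limit_point_ge.
- exact: alpha1.
- exact: alpha_lt.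
- exact: alpha_cvg.
Qed.
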